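(* Let $H\in(\tfrac12,1)$ and let $(L_t)_{t\in\mathbb R}$ be a two-sided Lévy process without Gaussian component, with nonzero Lévy measure $\nu$ and $\mathbb E L_1=0$. Let $X_t=\int_{-\infty}^t f_H(t,s)\,dL_s$ ($t\in\mathbb R$) be the fLpMvN and $Y_t=\int_0^t z_H(t,s)\,dL_s$ ($t\ge0$) the fLpMG driven by $L$. 1) If $\mathbb E|L_1|^3<\infty$ and $\mathbb E L_1^3\neq 0$, then $(X_t)_{t\ge0}$ and $(Y_t)_{t\ge0}$ have different finite dimensional distributions. 2) If $\mathbb E L_1^4<\infty$, then $(X_t)_{t\ge0}$ and $(Y_t)_{t\ge0}$ have different finite dimensional distributions.
   Context: A two-sided Lévy process is $L_t=L^{(1)}_t$ for $t\ge0$ and $L_t=-L^{(2)}_{-(t-)}$ for $t<0$, where $L^{(1)},L^{(2)}$ are i.i.d. Lévy processes; its characteristic triplet is that of $L^{(1)}$. With $\mathbb E L_1=0$, $\mathbb E L_1^2<\infty$ and no Gaussian component, $\mathbb E e^{iuL_t}=\exp\big(t\int_{\mathbb R}(e^{iux}-1-iux)\nu(dx)\big)$. Mandelbrot–Van Ness kernel: $f_H(t,s)=C_H\big((t-s)_+^{H-1/2}-(-s)_+^{H-1/2}\big)$, $s,t\in\mathbb R$, with $C_H=\big(\int_0^\infty((1+s)^{H-1/2}-s^{H-1/2})^2ds+\tfrac1{2H}\big)^{-1/2}$. Molchan–Golosov kernel: $z_H(t,s)=c_H(t-s)^{H-1/2}F\big(\tfrac12-H,H-\tfrac12,H+\tfrac12,\tfrac{s-t}{s}\big)$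 for $0<s<t$, and $z_H(t,s)=0$ otherwise, where $F(a,b,c,x)=\sum_{j\ge0}\frac{(a)_j(b)_j}{(c)_j}\frac{x^j}{j!}$ is Gauss' hypergeometric function ($(a)_0=1$, $(a)_k=a(a+1)\cdots(a+k-1)$) and $c_H=\frac{1}{\Gamma(H+1/2)}\big(\frac{2H\Gamma(H+1/2)\Gamma(3/2-H)}{\Gamma(2-2H)}\big)^{1/2}$. For $H>\tfrac12$ one has $z_H(t,s)=(H-\tfrac12)c_Hs^{1/2-H}\int_s^t u^{H-1/2}(u-s)^{H-3/2}du$, $0<s<t$. The stochastic integrals of deterministic kernels with respect to $L$ are defined as $L^2(\mathbb P)$-limits (equivalently limits in probability) of integrals of step functions. *)

(* Defs.v *)
From HB Require Import structures.
From mathcomp Require Import all_boot all_order all_algebra.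
From mathcomp Require Import all_classical all_reals all_analysis.
Set Implicit Arguments. Unset Strict Implicit. Unset Printing Implicit Defensive.
Import Order.TTheory GRing.Theory Num.Def Num.Theory.
Import numFieldNormedType.Exports.
Local Open Scope classical_set_scope.
Local Open Scope ring_scope.

Section Defs.
Context {d : measure_display} {T : measurableType d} {R : realType}.
Variable P : probability T R.

Definition rvec (Z : R -> T -> R) (n : nat) (ts : n.-tuple R) (w : T)
  : n.-tuple R := map_tuple (fun t => Z t w) ts.

Definition same_fdd (Z1 Z2 : R -> T -> R) : Prop :=
  forall (n : nat) (ts : n.-tuple R), (forall i, 0 <= tnth ts i) ->
  forall B : set (n.-tuple R), measurable B ->
    P [set w | B (rvec Z1 ts w)] = P [set w | B (rvec Z2 ts w)].

Definition mutually_independent (n : nat) (Z : 'I_n -> T -> R) : Prop :=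
  forall B : 'I_n -> set R, (forall i, measurable (B i)) ->
    P [set w | forall i, B i (Z i w)] = (\prod_(i < n) P [set w | B i (Z i w)])%E.

Definition independent_processes (Z1 Z2 : R -> T -> R) : Prop :=
  forall (n m : nat) (ts : n.-tuple R) (ss : m.-tuple R),
  (forall i, 0 <= tnth ts i) -> (forall j, 0 <= tnth ss j) ->
  forall (A : set (n.-tuple R)) (B : set (m.-tuple R)),
    measurable A -> measurable B ->
    P [set w | A (rvec Z1 ts w) /\ B (rvec Z2 ss w)] =
    (P [set w | A (rvec Z1 ts w)] * P [set w | B (rvec Z2 ss w)])%E.

Definition cadlag (f : R -> R) : Prop :=
  (forall t, 0 <= t -> f @ t^'+ --> f t) /\
  (forall t, 0 < t -> cvg (f @ t^'-)).

Definition levy_process (Lp : R -> T -> R) : Prop :=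
  [/\ forall t, 0 <= t -> measurable_fun setT (Lp t),
      P [set w | Lp 0 w = 0] = 1%E,
      (forall (n : nat) (t : nat -> R), 0 <= t 0%N ->
         (forall i, (i < n)%N -> t i < t i.+1) ->
         mutually_independent (fun i : 'I_n => fun w => Lp (t i.+1) w - Lp (t i) w)),
      (forall s t, 0 <= s -> s <= t -> forall B : set R, measurable B ->
         P [set w | B (Lp t w - Lp s w)] = P [set w | B (Lp (t - s) w)]) &
      {ae P, forall w, cadlag (fun t => Lp t w)}].

Definition two_sided (L1 L2 : R -> T -> R) (t : R) (w : T) : R :=
  if 0 <= t then L1 t w else - lim ((fun x => L2 x w) @ (- t)^'-).

(* step functions s |-> sum_k c_k 1_{(a_k, b_k]}(s), coded as lists of
   ((c_k, a_k), b_k) *)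
Definition stepfun (phi : seq (R * R * R)) (s : R) : R :=
  \sum_(p <- phi) p.1.1 * (if (p.1.2 < s) && (s <= p.2) then 1 else 0).

Definition step_integral (L : R -> T -> R) (phi : seq (R * R * R)) (w : T) : R :=
  \sum_(p <- phi) p.1.1 * (if p.1.2 < p.2 then L p.2 w - L p.1.2 w else 0).

Definition is_stoch_integral (L : R -> T -> R) (f : R -> R) (Z : T -> R) : Prop :=
  measurable_fun setT Z /\
  exists phi : nat -> seq (R * R * R),
    (fun m => \int[lebesgue_measure]_s (`|stepfun (phi m) s - f s| ^+ 2)%:E)%E
      @ \oo --> 0%E /\
    (fun m => \int[P]_w (`|step_integral L (phi m) w - Z w| ^+ 2)%:E)%E
      @ \oo --> 0%E.

End Defs.

Section Kernels.
Context {R : realType}.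

Definition posp (x : R) : R := Num.max x 0.

Definition Gamma (x : R) : R :=
  Rintegral lebesgue_measure [set t | 0 < t] (fun t => t `^ (x - 1) * expR (- t)).

Definition C_H (H : R) : R :=
  (Rintegral lebesgue_measure [set s | 0 <= s]
     (fun s => ((1 + s) `^ (H - 2^-1) - s `^ (H - 2^-1)) ^+ 2)
   + (2 * H)^-1) `^ (- 2^-1).

Definition f_H (H t s : R) : R :=
  C_H H * (posp (t - s) `^ (H - 2^-1) - posp (- s) `^ (H - 2^-1)).

Definition c_H (H : R) : R :=
  (Gamma (H + 2^-1))^-1 *
  Num.sqrt (2 * H * Gamma (H + 2^-1) * Gamma (3 / 2 - H) / Gamma (2 - 2 * H)).

(* Molchan--Golosov kernel, in its integral form valid for H > 1/2 *)
Definition z_H (H t s : R) : R :=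
  if (0 < s) && (s < t) then
    (H - 2^-1) * c_H H * s `^ (2^-1 - H) *
    Rintegral lebesgue_measure [set u | s <= u <= t]
      (fun u => u `^ (H - 2^-1) * (u - s) `^ (H - 3 / 2))
  else 0.

End Kernels.

(* Main.v *)
Require Import Defs.
From HB Require Import structures.
From mathcomp Require Import all_boot all_order all_algebra.
From mathcomp Require Import all_classical all_reals all_analysis.
From mathcomp Require Import measurable_realfun.
From mathcomp Require Import ring lra.
Set Implicit Arguments. Unset Strict Implicit. Unset Printing Implicit Defensive.
Import Order.TTheory GRing.Theory Num.Def Num.Theory.
Import numFieldNormedType.Exports.
Local Open Scope classical_set_scope.
Local Open Scope ring_scope.

(** Write q(u) = \int (1 - cos(ux)) nu(dx). Only moduli of characteristic
    functions are needed: by independence of increments and passage to the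
    L^2 limit, a stochastic integral Z = \int f dL satisfies
    |E exp(iZ)|^2 = exp(-2 \int q(f(s)) ds). Hence, if X and Y had the same
    finite dimensional distributions, then \int q(a f_1 + b f_t) ds would equal
    \int q(a z_1 + b z_t) ds for all a, b, and therefore so would the integrals
    of K(a f_1, b f_t) and K(a z_1, b z_t), where
    K(y, z) = q(y) + q(z) - q(y+z)/2 - q(y-z)/2
            = \int (1 - cos(xy)) (1 - cos(xz)) nu(dx) >= 0.
    Take b = a t^(1-2H) and let t -> oo. The Mandelbrot-Van Ness kernel grows
    only like t^(H-1/2) pointwise, so b f_t -> 0 and the first integral tends
    to 0 by dominated convergence. The Molchan-Golosov kernel grows like
    t^(2H-1) s^(1/2-H), so the second integral stays bounded away from 0.
    This settles both parts at once. *)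

(** * Trigonometric and real lemmas *)

Section real_lemmas.
Context {R : realType}.
Implicit Types (x y z w a b : R).

(** The obstacle is that the scaled variable b X_t does not become small: X_t has variance of order
    t^(2H), so the L^2 norm of b f_t is of order t^(1-H) and its mass escapes to large |s|.
    Comparing the integrals of q(b f_t) and q(b z_t) alone therefore shows nothing. The mixed term
    anchors the comparison at time 1: K(y, z) <= 2 q(y), so 2 q(a f_1) dominates for every t and
    pointwise smallness of b f_t is enough, while nonnegativity of K lets the second integral be
    bounded below by its part over [1/4, 1/2]. There b z_t(s) lies between positive constants
    uniformly in t, which is what dictates the scale t^(1-2H). The finite second moment of L_1 is
    first transferred to [nu]. It makes q Lipschitz in u^2, the regularity that matches L^2
    approximation of kernels by step functions. The constant c_H is an expression in Gamma
    integrals; the case where it vanishes is treated separately, by a contradiction at time 1. *)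

Lemma is_lipschitz_sin_cos a b : a <= b ->
  `|sin b - sin a| <= b - a /\ `|cos b - cos a| <= b - a.
Proof.
move=> ab; split.
- have [|c _ ->] := @MVT_segment R sin cos a b ab.
  - apply: continuous_subspaceT; exact: continuous_sin.
  by rewrite normrM (ger0_norm (_ : 0 <= b - a)) ?subr_ge0// ler_piMl ?subr_ge0// cos_max.
- have [|c _ ->] := @MVT_segment R cos (fun x => - sin x) a b ab.
  - apply: continuous_subspaceT; exact: continuous_cos.
  by rewrite normrM normrN (ger0_norm (_ : 0 <= b - a)) ?subr_ge0// ler_piMl ?subr_ge0// sin_max.
Qed.

Lemma ler_dist_sin a b : `|sin a - sin b| <= `|a - b|.
Proof.
wlog ab : a b / a <= b.
  by move=> h; have [/h//|/ltW/h] := leP a b; rewrite distrC (distrC a).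
have [h _] := is_lipschitz_sin_cos ab.
by rewrite distrC (distrC a) (le_trans h)// ler_norm.
Qed.

Lemma ler_dist_cos a b : `|cos a - cos b| <= `|a - b|.
Proof.
wlog ab : a b / a <= b.
  by move=> h; have [/h//|/ltW/h] := leP a b; rewrite distrC (distrC a).
have [_ h] := is_lipschitz_sin_cos ab.
by rewrite distrC (distrC a) (le_trans h)// ler_norm.
Qed.

Lemma ler_norm_sin x : `|sin x| <= `|x|.
Proof. by have := ler_dist_sin x 0; rewrite sin0 !subr0. Qed.

Lemma cosB_prod a b :
  cos a - cos b = 2 * (sin ((b + a) / 2) * sin ((b - a) / 2)).
Proof.
have -> : cos a = cos ((b + a) / 2 - (b - a) / 2) by congr cos; field.
have -> : cos b = cos ((b + a) / 2 + (b - a) / 2) by congr cos; field.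
by rewrite cosB cosD; ring.
Qed.

(** Comparing squares lets x^2 factor out when a = y x and b = z x, so the second moment of [nu]
    controls the variation of q. *)
Lemma ler_dist_cos_sqr a b : `|cos a - cos b| <= `|a ^+ 2 - b ^+ 2| / 2.
Proof.
rewrite cosB_prod !normrM (@ger0_norm _ 2)//.
have -> : `|a ^+ 2 - b ^+ 2| / 2 = 2 * (`|(b + a) / 2| * `|(b - a) / 2|).
  rewrite -normrM (_ : a ^+ 2 - b ^+ 2 = - (4 * ((b + a) / 2 * ((b - a) / 2)))); last by field.
  by rewrite normrN (normrM 4) (@ger0_norm _ 4)//; field.
by rewrite ler_pM2l// ler_pM// ler_norm_sin.
Qed.

Lemma onesubcos_ge0 w : 0 <= 1 - cos w.
Proof. by rewrite subr_ge0 cos_le1. Qed.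

Lemma onesubcos_le2 w : 1 - cos w <= 2.
Proof. by have := cos_geN1 w; lra. Qed.

Lemma onesubcos_le w : 1 - cos w <= w ^+ 2 / 2.
Proof.
have := ler_dist_cos_sqr 0 w; rewrite cos0 ger0_norm ?onesubcos_ge0//.
by rewrite expr0n/= sub0r normrN ger0_norm// sqr_ge0.
Qed.

(** For 0 <= w <= 1 the mean value theorem gives sin(w/2) = cos(c) w/2 with cos c >= 1/2, hence
    sin(w/2) >= w/4; then 1 - cos w = 2 sin(w/2)^2. *)
Lemma onesubcos_ge w : `|w| <= 1 -> w ^+ 2 / 8 <= 1 - cos w.
Proof.
wlog w0 : w / 0 <= w.
  move=> h; have [/h//|/ltW w0 w1] := leP 0 w.
  by have := h (- w); rewrite oppr_ge0 normrN sqrrN cosN; exact.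
rewrite ger0_norm// => w1.
have w20 : 0 <= w / 2 by lra.
have [|c] := @MVT_segment R sin cos 0 (w / 2) w20.
- apply: continuous_subspaceT; exact: continuous_sin.
rewrite in_itv/= sin0 !subr0 => /andP[c0 cw] sE.
have c2 : 2^-1 <= cos c.
  have := onesubcos_le c; have : c ^+ 2 <= 1 by rewrite expr_le1//; lra.
  by lra.
have h : 0 <= w / 4 <= sin (w / 2) by rewrite sE; nra.
have := cosB_prod 0 w; rewrite cos0 addr0 subr0 => ->.
by move: h; set s := sin _; nra.
Qed.

Lemma product_onesubcos a b : (1 - cos a) * (1 - cos b) =
  (1 - cos a) + (1 - cos b) - (1 - cos (a + b)) / 2 - (1 - cos (a - b)) / 2.
Proof. by rewrite cosD cosB; field. Qed.

(** Cauchy's equation, with nonnegativity in place of continuity: it makes f monotone, and comparing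
    N t with its integer part bounds N |f t - t f 1| by f 1 for every N. *)
Lemma additive_ge0_linear (f : R -> R) :
  (forall s t, 0 < s -> 0 < t -> f (s + t) = f s + f t) ->
  (forall t, 0 < t -> 0 <= f t) -> forall t, 0 < t -> f t = t * f 1.
Proof.
move=> fD f0.
have fMn n t : 0 < t -> f (n.+1%:R * t) = n.+1%:R * f t.
  move=> t0; elim: n => [|n IH]; first by rewrite !mul1r.
  by rewrite -natr1 mulrDl mul1r fD// ?mulr_gt0// IH; ring.
have fle s t : 0 < s -> s <= t -> f s <= f t.
  move=> s0; rewrite le_eqVlt => /predU1P[->//|st].
  by rewrite -(subrK s t) fD ?subr_gt0// lerDr f0// subr_gt0.
move=> t t0; apply/eqP; rewrite -subr_eq0 -normr_le0; apply/ler_addgt0Pl => e e0.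
rewrite addr0.
have f10 := f0 1 ltr01.
have [n ne] : exists n, f 1 / e < n.+1%:R.
  exists (Num.truncn (f 1 / e)); rewrite truncnS_gt//.
set N : R := n.+1%:R; have N0 : 0 < N by rewrite ltr0n.
pose k := Num.truncn (N * t).
have /andP[k1 k2] : k%:R <= N * t < k.+1%:R.
  by apply: truncn_itv; rewrite mulr_ge0// ltW.
have h1 : k%:R * f 1 <= N * f t.
  rewrite -fMn//; case: k k1 {k2} => [|k] k1; first by rewrite mul0r f0// mulr_gt0.
  by rewrite -fMn// mulr1 fle// ltr0n.
have h2 : N * f t <= k.+1%:R * f 1.
  by rewrite -!fMn// mulr1 fle ?mulr_gt0// ltW.
have : `|N * (f t - t * f 1)| <= f 1.
  rewrite ler_norml; apply/andP; split; rewrite -natr1 in h2 k2; nra.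
rewrite normrM gtr0_norm// => h3.
have : N * `|f t - t * f 1| <= N * e.
  by rewrite (le_trans h3)//; move: ne; rewrite ltr_pdivrMr// => /ltW.
by rewrite ler_pM2l.
Qed.

(** The hypothesis is the shape produced by Young's inequality r <= eps + r^2/eps: a fixed small
    error plus a large multiple of a squared L^2 distance. It stands in for Cauchy-Schwarz in both
    limit passages. *)
Lemma cvg0_eps (a : nat -> R) (l C : R) (e : nat -> \bar R) :
  (forall eps m, 0 < eps <= 1 ->
     (`|a m - l|%:E <= (C * eps)%:E + (C / eps)%:E * e m)%E) ->
  0 < C -> e @ \oo --> 0%E -> a @ \oo --> l.
Proof.
move=> h C0 e0; apply/cvgrPdist_le => /= d d0.
pose eps := Num.min 1 (d / (2 * C)).
have eps0 : 0 < eps by rewrite lt_min ltr01 divr_gt0// mulr_gt0.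
have eps1 : eps <= 1 by rewrite ge_min lexx.
have Ceps : C * eps <= d / 2.
  have : eps <= d / (2 * C) by rewrite ge_min lexx orbT.
  rewrite ler_pdivlMr ?mulr_gt0// => ?; lra.
(* Chosen so that (C / eps) del = d / 2; the other half of d pays for C eps. *)
pose del := eps / C * (d / 2).
have del0 : 0 < del by rewrite mulr_gt0// divr_gt0.
have e0' : \forall m \near \oo, (e m < del%:E)%E.
  have [efin efine] := (fine_cvgP e 0).1 e0.
  near=> m; rewrite -[e m]fineK; last by near: m.
  rewrite lte_fin; near: m.
  by have := @cvgr_lt _ _ _ _ _ _ efine del del0; exact.
near=> m.
rewrite distrC -lee_fin (le_trans (h eps m _))// ?eps0//.
have : (e m <= del%:E)%E by apply/ltW; near: m.
move=> em; apply: (@le_trans _ _ ((C * eps)%:E + (C / eps)%:E * del%:E)%E).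
  by rewrite leeD2l// lee_pmul2l// lte_fin divr_gt0.
rewrite -EFinM -EFinD lee_fin.
have -> : C / eps * del = d / 2.
  by rewrite /del; field; rewrite !gt_eqF.
lra.
Unshelve. all: by end_near. Qed.

End real_lemmas.

(** * Expectations of bounded functions *)

Section bounded_measurable.
Context {d : measure_display} {T : measurableType d} {R : realType}.
Implicit Types (h k : T -> R).

Definition bounded_mfun h := measurable_fun setT h /\ exists M, forall w, `|h w| <= M.

Lemma bounded_mfun_cst (c : R) : bounded_mfun (fun=> c).
Proof. by split; [exact: measurable_cst|exists `|c|]. Qed.

Lemma bounded_mfunD h k : bounded_mfun h -> bounded_mfun k ->
  bounded_mfun (fun w => h w + k w).
Proof.
move=> [mh [M hM]] [mk [N kN]]; split; first exact: measurable_funD.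
by exists (M + N) => w; rewrite (le_trans (ler_normD _ _))// lerD.
Qed.

Lemma bounded_mfunM h k : bounded_mfun h -> bounded_mfun k ->
  bounded_mfun (fun w => h w * k w).
Proof.
move=> [mh [M hM]] [mk [N kN]]; split; first exact: measurable_funM.
by exists (M * N) => w; rewrite normrM ler_pM.
Qed.

Lemma bounded_mfunZ c h : bounded_mfun h -> bounded_mfun (fun w => c * h w).
Proof. by move=> bh; apply: bounded_mfunM => //; exact: bounded_mfun_cst. Qed.

Lemma bounded_mfunB h k : bounded_mfun h -> bounded_mfun k ->
  bounded_mfun (fun w => h w - k w).
Proof.
move=> bh bk; under eq_fun do rewrite -[- k _]mulN1r.
by apply: bounded_mfunD => //; exact: bounded_mfunZ.
Qed.

Lemma bounded_mfun_sum (I : Type) (s : seq I) (h : I -> T -> R) :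
  (forall i, bounded_mfun (h i)) -> bounded_mfun (fun w => \sum_(i <- s) h i w).
Proof.
move=> bh; elim: s => [|i s IH].
  by under eq_fun do rewrite big_nil; exact: bounded_mfun_cst.
by under eq_fun do rewrite big_cons; exact: bounded_mfunD.
Qed.

Lemma bounded_mfun_prod (I : Type) (s : seq I) (p : pred I) (h : I -> T -> R) :
  (forall i, bounded_mfun (h i)) -> bounded_mfun (fun w => \prod_(i <- s | p i) h i w).
Proof.
move=> bh; elim: s => [|i s IH].
  by under eq_fun do rewrite big_nil; exact: bounded_mfun_cst.
under eq_fun do rewrite big_cons; case: (p i) => //; exact: bounded_mfunM.
Qed.

Lemma bounded_mfun_indic (B : set T) : measurable B -> bounded_mfun (\1_B : T -> R).
Proof.
move=> mB; split; first exact: measurable_indic.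
by exists 1 => w; rewrite indicE ger0_norm// lern1 leq_b1.
Qed.

Lemma bounded_mfun_integrable (P : probability T R) h :
  bounded_mfun h -> P.-integrable setT (EFin \o h).
Proof.
move=> [mh [M hM]]; apply: (@le_integrable _ _ _ P setT measurableT _ (cst M%:E)).
- exact/measurable_EFinP.
- by move=> w _ /=; rewrite lee_fin (le_trans (hM w))// ler_norm.
- exact: finite_measure_integrable_cst.
Qed.

End bounded_measurable.

Lemma bounded_mfun_comp {d d' : measure_display} {T : measurableType d}
  {T' : measurableType d'} {R : realType} (g : T' -> R) (Z : T -> T') :
  bounded_mfun g -> measurable_fun setT Z -> bounded_mfun (fun w => g (Z w)).
Proof.
move=> [mg [M gM]] mZ; split; first exact: measurableT_comp.
by exists M.
Qed.

Lemma bounded_mfun_cos {R : realType} : bounded_mfun (@cos R).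
Proof.
split; last by exists 1 => ?; exact: cos_max.
apply: continuous_measurable_fun; exact: continuous_cos.
Qed.

Lemma bounded_mfun_sin {R : realType} : bounded_mfun (@sin R).
Proof.
split; last by exists 1 => ?; exact: sin_max.
apply: continuous_measurable_fun; exact: continuous_sin.
Qed.

Section expectation_of_bounded.
Context {d : measure_display} {T : measurableType d} {R : realType}.
Variable P : probability T R.
Implicit Types (h k W U V : T -> R).

Definition Ex h : R := Rintegral P setT h.

Lemma eq_Ex h k : h =1 k -> Ex h = Ex k.
Proof. by move=> /funext ->. Qed.

Lemma ExE h : bounded_mfun h -> (\int[P]_w (h w)%:E)%E = (Ex h)%:E.
Proof.
move=> bh; rewrite fineK//; apply: integrable_fin_num => //.
exact: bounded_mfun_integrable.
Qed.

Lemma ExD h k : bounded_mfun h -> bounded_mfun k ->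
  Ex (fun w => h w + k w) = Ex h + Ex k.
Proof. by move=> bh bk; apply: RintegralD => //; exact: bounded_mfun_integrable. Qed.

Lemma ExB h k : bounded_mfun h -> bounded_mfun k ->
  Ex (fun w => h w - k w) = Ex h - Ex k.
Proof. by move=> bh bk; apply: RintegralB => //; exact: bounded_mfun_integrable. Qed.

Lemma ExZ c h : bounded_mfun h -> Ex (fun w => c * h w) = c * Ex h.
Proof. by move=> bh; apply: RintegralZl => //; exact: bounded_mfun_integrable. Qed.

Lemma Ex_cst c : Ex (fun=> c) = c.
Proof.
rewrite /Ex Rintegral_cst// -[RHS]mulr1; congr (_ * _).
by rewrite -[RHS]/(fine 1%E); congr fine; exact: probability_setT.
Qed.

Lemma Ex_sum (I : Type) (s : seq I) (h : I -> T -> R) :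
  (forall i, bounded_mfun (h i)) ->
  Ex (fun w => \sum_(i <- s) h i w) = \sum_(i <- s) Ex (h i).
Proof.
move=> bh; elim: s => [|i s IH].
  by under eq_Ex do rewrite big_nil; rewrite Ex_cst big_nil.
under eq_Ex do rewrite big_cons; rewrite ExD// ?IH ?big_cons//.
exact: bounded_mfun_sum.
Qed.

Lemma le_Ex h k : bounded_mfun h -> bounded_mfun k -> (forall w, h w <= k w) ->
  Ex h <= Ex k.
Proof.
by move=> bh bk hk; apply: le_Rintegral => //; exact: bounded_mfun_integrable.
Qed.

Lemma Ex_norm_le h c : bounded_mfun h -> (forall w, `|h w| <= c) -> `|Ex h| <= c.
Proof.
move=> bh hc; rewrite ler_norml -(Ex_cst c) -mulN1r -ExZ; last exact: bounded_mfun_cst.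
by apply/andP; split; apply: le_Ex => //;
  rewrite /bounded_mfun ?mulN1r; try exact: bounded_mfun_cst;
  move=> w; have := hc w; rewrite ler_norml ?mulN1r => /andP[].
Qed.

Lemma Ex_indic (B : set T) : measurable B -> (Ex \1_B)%:E = P B.
Proof.
move=> mB; rewrite -ExE; last exact: bounded_mfun_indic.
by rewrite integral_indic// setIT.
Qed.

Lemma Ex_same_law U V : measurable_fun setT U -> measurable_fun setT V ->
  (forall B : set R, measurable B -> P [set w | B (U w)] = P [set w | B (V w)]) ->
  forall g : R -> R, bounded_mfun g -> Ex (fun w => g (U w)) = Ex (fun w => g (V w)).
Proof.
move=> mU mV h g bg; congr fine.
have mg : measurable_fun setT (EFin \o g) by apply/measurable_EFinP; case: bg.
have gU (Z : T -> R) : measurable_fun setT Z ->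
    (\int[P]_w (g (Z w))%:E = \int[pushforward P Z]_x (g x)%:E)%E.
  move=> mZ; rewrite (@integral_pushforward _ _ _ _ _ _ mZ P setT (EFin \o g))//.
  rewrite preimage_setT; apply: bounded_mfun_integrable.
  exact: bounded_mfun_comp.
rewrite (gU U)// (gU V)//.
by apply: eq_measure_integral => B mB _; exact: h.
Qed.

(* Approximating [g] uniformly by [truncn (n g) / n] reduces bounded functions
   to indicators. *)
Lemma Ex_factor W U : bounded_mfun W -> measurable_fun setT U ->
  (forall B : set R, measurable B ->
     Ex (fun w => W w * \1_B (U w)) = Ex W * Ex (fun w => \1_B (U w))) ->
  forall g : R -> R, bounded_mfun g ->
    Ex (fun w => W w * g (U w)) = Ex W * Ex (fun w => g (U w)).
Proof.
move=> bW mU h.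
have pos (g : R -> R) : bounded_mfun g -> (forall x, 0 <= g x) ->
    Ex (fun w => W w * g (U w)) = Ex W * Ex (fun w => g (U w)).
  move=> bg g0; have [mg [M gM]] := bg; have [_ [N WN]] := bW.
  have N0 : 0 <= N by rewrite (le_trans (normr_ge0 _) (WN point)).
  apply/eqP; rewrite -subr_eq0 -normr_le0; apply/ler_addgt0Pl => e e0.
  rewrite addr0.
  have [n ne] : exists n, (2 * N) / e < n.+1%:R.
    by exists (Num.truncn (2 * N / e)); rewrite truncnS_gt.
  set r : R := n.+1%:R; have r0 : 0 < r by rewrite ltr0n.
  pose B (k : nat) := [set x : R | Num.truncn (r * g x) == k].
  have mB (k : nat) : measurable (B k).
    rewrite (_ : B k = setT `&` g @^-1` `[k%:R / r, k.+1%:R / r[).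
      by apply: mg => //; exact: measurable_itv.
    apply/seteqP; split => x /=; rewrite /B/= in_itv/=.
      move=> /eqP <-; split => //; rewrite ler_pdivrMr// ltr_pdivlMr// (mulrC _ r).
      by apply: truncn_itv; rewrite mulr_ge0// ltW.
    move=> [_]; rewrite ler_pdivrMr// ltr_pdivlMr// (mulrC _ r) => xk.
    exact/eqP/truncn_def.
  pose K := (Num.truncn (r * M)).+1.
  pose gn x : R := \sum_(k < K) (k%:R / r) * \1_(B k) x.
  have bi (k : nat) : bounded_mfun (fun w => \1_(B k) (U w) : R).
    by apply: bounded_mfun_comp => //; exact: bounded_mfun_indic.
  have gnE : Ex (fun w => W w * gn (U w)) = Ex W * Ex (fun w => gn (U w)).
    under eq_Ex do rewrite /gn mulr_sumr; under eq_Ex => w.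
      under eq_bigr do rewrite mulrCA. over.
    rewrite Ex_sum; last by move=> i; apply/bounded_mfunZ/bounded_mfunM.
    rewrite /gn Ex_sum; last by move=> i; exact: bounded_mfunZ.
    rewrite mulr_sumr; apply: eq_bigr => k _.
    rewrite ExZ; last exact: bounded_mfunM.
    by rewrite ExZ// h//; ring.
  have gnx x : gn x = (Num.truncn (r * g x))%:R / r.
    have xK : (Num.truncn (r * g x) < K)%N.
      rewrite ltnS le_truncn// ler_pM2l//.
      by rewrite (le_trans _ (gM x))// ler_norm.
    rewrite /gn (bigD1 (Ordinal xK))//= big1 ?addr0; last first.
      move=> i /eqP ik; rewrite indicE memNset ?mulr0// => /eqP /= iE.
      by apply: ik; apply/val_inj.
    by rewrite indicE mem_set ?mulr1// /B/=.
  have gng x : `|g x - gn x| <= r^-1.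
    rewrite gnx; have /andP[t1 t2] :
        (Num.truncn (r * g x))%:R <= r * g x < (Num.truncn (r * g x)).+1%:R.
      by apply: truncn_itv; rewrite mulr_ge0// ltW.
    have gE : g x = r * g x / r by rewrite mulrAC divff ?mul1r// gt_eqF.
    rewrite {1}gE -mulrBl normrM (@gtr0_norm _ r^-1) ?invr_gt0//.
    rewrite ler_piMl ?invr_ge0 ?(ltW r0)// ger0_norm ?subr_ge0//.
    by rewrite -natr1 in t2; lra.
  have bgU : bounded_mfun (fun w => g (U w)) by exact: bounded_mfun_comp.
  have bgn : bounded_mfun (fun w => gn (U w)).
    by apply: bounded_mfun_sum => i; exact: bounded_mfunZ.
  (* Since [gn] factors exactly, only the error g - gn survives, and each of its two occurrences
     costs at most N / r. *)
  have -> : Ex (fun w => W w * g (U w)) - Ex W * Ex (fun w => g (U w)) =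
      Ex (fun w => W w * (g (U w) - gn (U w))) -
      Ex W * Ex (fun w => g (U w) - gn (U w)).
    have -> : Ex (fun w => W w * (g (U w) - gn (U w))) =
        Ex (fun w => W w * g (U w)) - Ex (fun w => W w * gn (U w)).
      rewrite -ExB; [|exact: bounded_mfunM|exact: bounded_mfunM].
      by apply: eq_Ex => w; rewrite mulrBr.
    by rewrite ExB// gnE; ring.
  have bd : bounded_mfun (fun w => g (U w) - gn (U w)) by exact: bounded_mfunB.
  apply: (@le_trans _ _ (2 * N / r)).
    rewrite (le_trans (ler_normB _ _))//.
    have -> : 2 * N / r = N / r + N / r by ring.
    apply: lerD.
      apply: Ex_norm_le; first exact: bounded_mfunM.
      by move=> w; rewrite normrM ler_pM.
    rewrite normrM ler_pM//; first exact: Ex_norm_le.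
    exact: Ex_norm_le.
  by rewrite ler_pdivrMr// -ler_pdivrMl// mulrC ltW.
move=> g bg; have [_ [M gM]] := bg.
have bg' : bounded_mfun (fun x => g x + M) by apply: bounded_mfunD => //; exact: bounded_mfun_cst.
have bgU : bounded_mfun (fun w => g (U w)) by exact: bounded_mfun_comp.
have g'0 x : 0 <= g x + M by have := gM x; rewrite ler_norml => /andP[? _]; lra.
have := pos _ bg' g'0.
rewrite ExD//; last exact: bounded_mfun_cst.
under eq_Ex do rewrite mulrDr; rewrite ExD; last 2 first.
- exact: bounded_mfunM.
- by apply: bounded_mfunM => //; exact: bounded_mfun_cst.
under [X in _ + X = _ -> _]eq_Ex do rewrite mulrC.
by rewrite ExZ// Ex_cst => ?; lra.
Qed.

End expectation_of_bounded.

(** * Independence and moduli of characteristic functions *)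

Section independence.
Context {d : measure_display} {T : measurableType d} {R : realType}.
Variable P : probability T R.
Local Notation Ex := (Ex P).
Implicit Types (U V W : T -> R).

(** Indicators are replaced by bounded functions one coordinate at a time. In the auxiliary claim
    the coordinates below k are arbitrary and the others are indicators: k = 0 is independence
    itself, and each step is [Ex_factor] in one coordinate. *)
Lemma Ex_prod_independent (n : nat) (Z : 'I_n -> T -> R) :
  (forall i, measurable_fun setT (Z i)) -> mutually_independent P Z ->
  forall h : 'I_n -> R -> R, (forall i, bounded_mfun (h i)) ->
  Ex (fun w => \prod_(i < n) h i (Z i w)) = \prod_(i < n) Ex (fun w => h i (Z i w)).
Proof.
move=> mZ indZ.
suff ind k : forall h : 'I_n -> R -> R, (forall i, bounded_mfun (h i)) ->
    (forall i : 'I_n, (k <= i)%N -> exists B, measurable B /\ h i = \1_B) ->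
    Ex (fun w => \prod_(i < n) h i (Z i w)) = \prod_(i < n) Ex (fun w => h i (Z i w)).
  by move=> h bh; apply: (ind n) => // i; rewrite leqNgt ltn_ord.
elim: k => [|k IH] h bh hB.
  have /choice[B BP] : forall i, exists B, measurable B /\ h i = \1_B by move=> i; exact: hB.
  have mB i : measurable (B i) by case: (BP i).
  have hE i : h i = \1_(B i) by case: (BP i).
  have mZB i : measurable [set w | B i (Z i w)].
    by rewrite -[X in measurable X]setTI; exact: mZ.
  apply/EFin_inj; rewrite -prodEFin.
  transitivity (P [set w | forall i, B i (Z i w)]).
    rewrite -Ex_indic; last first.
      rewrite (_ : mkset _ = \bigcap_(i in setT) [set w | B i (Z i w)]).
        by apply: fin_bigcap_measurable => // i _; exact: mZB.
      by apply/seteqP; split => w /= h' i => [_|]; exact: h'.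
    congr EFin; apply: eq_Ex => w; rewrite indicE.
    have [h'|h'] := pselect (forall i, B i (Z i w)).
      by rewrite mem_set// big1// => i _; rewrite hE indicE mem_set.
    rewrite memNset//; have [i Bi] := (existsNP _).2 h'.
    by rewrite (bigD1 i)//= hE indicE memNset ?mul0r.
  rewrite indZ//; apply: eq_bigr => i _.
  by rewrite -Ex_indic//; congr EFin; apply: eq_Ex => w; rewrite hE !indicE.
have [kn|nk] := ltnP k n; last first.
  by apply: IH => // i ki; have := leq_trans nk ki; rewrite leqNgt ltn_ord.
pose i0 := Ordinal kn.
pose W w := \prod_(i < n | i != i0) h i (Z i w).
have bhZ i : bounded_mfun (fun w => h i (Z i w)) by exact: bounded_mfun_comp.
have bW : bounded_mfun W by exact: bounded_mfun_prod.
have key (B : set R) : measurable B ->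
    Ex (fun w => W w * \1_B (Z i0 w)) =
    \prod_(i < n | i != i0) Ex (fun w => h i (Z i w)) * Ex (fun w => \1_B (Z i0 w)).
  move=> mB; pose h' i := if i == i0 then \1_B else h i.
  have -> : Ex (fun w => W w * \1_B (Z i0 w)) =
      Ex (fun w => \prod_(i < n) h' i (Z i w)).
    apply: eq_Ex => w; rewrite [in RHS](bigD1 i0)//= /h' eqxx mulrC; congr (_ * _).
    by apply: eq_bigr => i /negbTE ->.
  rewrite IH; last 2 first.
  - by move=> i; rewrite /h'; case: eqP => // _; exact: bounded_mfun_indic.
  - move=> i ki; rewrite /h'; case: eqP => [_|ii0]; first by exists B.
    apply: hB; rewrite ltn_neqAle ki andbT; apply/eqP => kE.
    by apply: ii0; exact/val_inj.
  rewrite (bigD1 i0)//= {1}/h' eqxx mulrC; congr (_ * _).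
  by apply: eq_bigr => i /negbTE ii0; rewrite /h' ii0.
(* The choice [B = setT] turns [key] into the factorization of W itself. *)
have WE : Ex W = \prod_(i < n | i != i0) Ex (fun w => h i (Z i w)).
  have := key setT measurableT.
  rewrite (_ : (fun w => \1_setT (Z i0 w)) = fun=> 1); last first.
    by apply/funext => w; rewrite indicE mem_set.
  rewrite Ex_cst mulr1 => <-; apply: eq_Ex => w.
  by rewrite indicE mem_set// mulr1.
have -> : Ex (fun w => \prod_(i < n) h i (Z i w)) = Ex (fun w => W w * h i0 (Z i0 w)).
  by apply: eq_Ex => w; rewrite (bigD1 i0)//= mulrC.
rewrite (bigD1 i0)//= mulrC -WE; apply: Ex_factor => //.
by move=> B mB; rewrite key// WE.
Qed.

Lemma Ex_prod_independent2 U V :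
  measurable_fun setT U -> measurable_fun setT V ->
  (forall A B : set R, measurable A -> measurable B ->
     P [set w | A (U w) /\ B (V w)] = (P [set w | A (U w)] * P [set w | B (V w)])%E) ->
  forall f g : R -> R, bounded_mfun f -> bounded_mfun g ->
  Ex (fun w => f (U w) * g (V w)) = Ex (fun w => f (U w)) * Ex (fun w => g (V w)).
Proof.
move=> mU mV indUV f g bf bg.
have mp (X : T -> R) (A : set R) : measurable_fun setT X -> measurable A ->
    measurable [set w | A (X w)].
  by move=> mX mA; rewrite -[X in measurable X]setTI; exact: mX.
have bi (X : T -> R) (A : set R) : measurable_fun setT X -> measurable A ->
    bounded_mfun (fun w => \1_A (X w) : R).
  by move=> mX mA; apply: bounded_mfun_comp => //; exact: bounded_mfun_indic.
have iE (X : T -> R) (A : set R) : measurable_fun setT X -> measurable A ->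
    (Ex (fun w => \1_A (X w)))%:E = P [set w | A (X w)].
  move=> mX mA; rewrite -Ex_indic; last exact: mp.
  by congr EFin; apply: eq_Ex => w; rewrite !indicE.
apply: Ex_factor => //; first exact: bounded_mfun_comp.
move=> B mB; rewrite mulrC; under eq_Ex do rewrite mulrC.
apply: Ex_factor => //; first exact: bi.
move=> A mA; apply/EFin_inj; rewrite EFinM !iE// muleC -indUV//.
rewrite -Ex_indic; last exact: (measurableI _ _ (mp _ _ mU mA) (mp _ _ mV mB)).
congr EFin; apply: eq_Ex => w; rewrite !indicE -natrM mulnb; congr (_%:R).
apply/esym; have [a|a] := boolP (U w \in A); have [b|b] := boolP (V w \in B);
  rewrite ?andbF//=.
- by rewrite mem_set//=; split; exact/set_mem.
- by rewrite memNset//= => -[_ /mem_set]; rewrite (negbTE b).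
- by rewrite memNset//= => -[/mem_set]; rewrite (negbTE a).
- by rewrite memNset//= => -[/mem_set]; rewrite (negbTE a).
Qed.

(** This is |E exp(iU)|^2 in real terms. *)
Definition charmod U : R :=
  Ex (fun w => cos (U w)) ^+ 2 + Ex (fun w => sin (U w)) ^+ 2.

Lemma charmod_ge0 U : 0 <= charmod U.
Proof. by rewrite addr_ge0// sqr_ge0. Qed.

(** With a and b the two expectations, a cos U + b sin U <= (a^2 + b^2 + 1)/2 pointwise, and the
    left side has expectation a^2 + b^2. *)
Lemma charmod_le1 U : measurable_fun setT U -> charmod U <= 1.
Proof.
move=> mU.
have bc : bounded_mfun (fun w => cos (U w)).
  exact: (bounded_mfun_comp bounded_mfun_cos).
have bs : bounded_mfun (fun w => sin (U w)).
  exact: (bounded_mfun_comp bounded_mfun_sin).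
rewrite /charmod; set a := Ex (fun w => cos _); set b := Ex (fun w => sin _).
have : Ex (fun w => a * cos (U w) + b * sin (U w)) <= Ex (fun=> 2^-1 * (a ^+ 2 + b ^+ 2 + 1)).
  apply: le_Ex; first by apply: bounded_mfunD; exact: bounded_mfunZ.
    exact: bounded_mfun_cst.
  move=> w; have := cos2Dsin2 (U w).
  have := sqr_ge0 (a - cos (U w)); have := sqr_ge0 (b - sin (U w)).
  by set c := cos _; set s := sin _ => ? ? ?; nra.
rewrite Ex_cst ExD ?ExZ//; [|exact: bounded_mfunZ|exact: bounded_mfunZ].
rewrite -/a -/b => ?; nra.
Qed.

Lemma charmod_same_law U V : measurable_fun setT U -> measurable_fun setT V ->
  (forall B : set R, measurable B -> P [set w | B (U w)] = P [set w | B (V w)]) ->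
  charmod U = charmod V.
Proof.
move=> mU mV h; rewrite /charmod !(Ex_same_law mU mV h)//.
  exact: bounded_mfun_sin.
exact: bounded_mfun_cos.
Qed.

(** Only cos V and sin V have to factor: the addition formulas use nothing more, and unlike full
    independence this passes easily from V to partial sums. *)
Definition decouple V U := forall f g : R -> R,
  (f = cos \/ f = sin) -> bounded_mfun g ->
  Ex (fun w => f (V w) * g (U w)) = Ex (fun w => f (V w)) * Ex (fun w => g (U w)).

Lemma Ex_cosD_sinD V U : measurable_fun setT V -> measurable_fun setT U ->
  decouple V U ->
  Ex (fun w => cos (V w + U w)) = Ex (fun w => cos (V w)) * Ex (fun w => cos (U w)) -
                                  Ex (fun w => sin (V w)) * Ex (fun w => sin (U w)) /\
  Ex (fun w => sin (V w + U w)) = Ex (fun w => sin (V w)) * Ex (fun w => cos (U w)) +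
                                  Ex (fun w => cos (V w)) * Ex (fun w => sin (U w)).
Proof.
move=> mV mU h.
have bc (X : T -> R) : measurable_fun setT X -> bounded_mfun (fun w => cos (X w)).
  by move=> mX; apply: bounded_mfun_comp => //; exact: bounded_mfun_cos.
have bs (X : T -> R) : measurable_fun setT X -> bounded_mfun (fun w => sin (X w)).
  by move=> mX; apply: bounded_mfun_comp => //; exact: bounded_mfun_sin.
have [bcos bsin] := (@bounded_mfun_cos R, @bounded_mfun_sin R).
split.
  under eq_Ex do rewrite cosD.
  rewrite ExB; [|by apply: bounded_mfunM; auto|by apply: bounded_mfunM; auto].
  by rewrite (h cos cos)// ?(h sin sin)//; [right|left].
under eq_Ex do rewrite sinD.
rewrite ExD; [|by apply: bounded_mfunM; auto|by apply: bounded_mfunM; auto].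
by rewrite (h sin cos)// ?(h cos sin)//; [left|right].
Qed.

Lemma charmodD V U : measurable_fun setT V -> measurable_fun setT U ->
  decouple V U -> charmod (fun w => V w + U w) = charmod V * charmod U.
Proof.
by move=> mV mU h; have [h1 h2] := Ex_cosD_sinD mV mU h; rewrite /charmod h1 h2; ring.
Qed.

(** The family is indexed by [nat] so that an induction on n can move the last variable into W
    without changing Z. *)
Definition decouples n W (Z : nat -> T -> R) := forall h : nat -> R -> R,
  (forall i, bounded_mfun (h i)) ->
  Ex (fun w => W w * \prod_(i < n) h i (Z i w)) =
  Ex W * \prod_(i < n) Ex (fun w => h i (Z i w)).

Lemma decouples_recr n W (Z : nat -> T -> R) (g : R -> R) :
  decouples n.+1 W Z -> bounded_mfun g ->
  Ex (fun w => W w * g (Z n w)) = Ex W * Ex (fun w => g (Z n w)) /\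
  decouples n (fun w => W w * g (Z n w)) Z.
Proof.
move=> dW bg.
have key (h : nat -> R -> R) : (forall i, bounded_mfun (h i)) ->
    Ex (fun w => W w * g (Z n w) * \prod_(i < n) h i (Z i w)) =
    Ex W * Ex (fun w => g (Z n w)) * \prod_(i < n) Ex (fun w => h i (Z i w)).
  move=> bh; pose h' i := if i == n then g else h i.
  have bh' i : bounded_mfun (h' i) by rewrite /h'; case: eqP.
  have neq (i : 'I_n) : (i == n :> nat) = false by apply/negbTE; rewrite neq_ltn ltn_ord.
  have h'n : h' n = g by rewrite /h' eqxx.
  have h'h (i : 'I_n) : h' i = h i by rewrite /h' neq.
  have := dW h' bh'; rewrite big_ord_recr/= h'n.
  under [X in _ * (X * _)]eq_bigr => i _ do rewrite h'h.
  rewrite -mulrA (mulrC (Ex (fun w => g _))) => <-.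
  apply: eq_Ex => w; rewrite big_ord_recr/= h'n -mulrA (mulrC (g _)).
  by congr (_ * (_ * _)); apply: eq_bigr => i _; rewrite h'h.
have E : Ex (fun w => W w * g (Z n w)) = Ex W * Ex (fun w => g (Z n w)).
  have /= := key (fun _ _ => 1) (fun=> bounded_mfun_cst 1).
  have -> : \prod_(i < n) Ex (fun=> 1) = 1 by rewrite big1// => i _; exact: Ex_cst.
  by rewrite mulr1 => <-; apply: eq_Ex => w; rewrite big1 ?mulr1.
by split => // h bh; rewrite key// E.
Qed.

(** The summand V is there for the induction, which replaces it by V + Z n. By the addition formulas
    the cosine and sine of the new V are combinations of products that still decouple from the
    remaining variables. *)
Lemma charmod_sum n V (Z : nat -> T -> R) :
  measurable_fun setT V -> (forall i, measurable_fun setT (Z i)) ->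
  decouples n (fun w => cos (V w)) Z -> decouples n (fun w => sin (V w)) Z ->
  charmod (fun w => V w + \sum_(i < n) Z i w) = charmod V * \prod_(i < n) charmod (Z i).
Proof.
elim: n V => [|n IH] V mV mZ dc ds.
  rewrite big_ord0 mulr1; congr charmod; apply/funext => w.
  by rewrite big_ord0 addr0.
have [bcos bsin] := (@bounded_mfun_cos R, @bounded_mfun_sin R).
have bV (f : R -> R) : bounded_mfun f -> bounded_mfun (fun w => f (V w)).
  by move=> bf; exact: bounded_mfun_comp.
have bZ i (f : R -> R) : bounded_mfun f -> bounded_mfun (fun w => f (Z i w)).
  by move=> bf; exact: bounded_mfun_comp.
have bP (h : nat -> R -> R) : (forall i, bounded_mfun (h i)) ->
    bounded_mfun (fun w => \prod_(i < n) h i (Z i w)).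
  by move=> bh; apply: bounded_mfun_prod => i; exact: bZ.
have dVZ : decouple V (Z n).
  by move=> f g [->|->] bg; [have [->] := decouples_recr dc bg|
                             have [->] := decouples_recr ds bg].
have [Ec Es] := Ex_cosD_sinD mV (mZ n) dVZ.
rewrite big_ord_recr/= (mulrC (\prod_(_ < _) _)) mulrA -charmodD// -IH//; last 3 first.
- exact: measurable_funD.
- move=> h bh; rewrite Ec.
  have [_ dcc] := decouples_recr dc bcos; have [_ dss] := decouples_recr ds bsin.
  under eq_Ex do rewrite cosD mulrBl.
  rewrite ExB; last 2 first.
  - by apply: bounded_mfunM; [apply: bounded_mfunM|]; auto.
  - by apply: bounded_mfunM; [apply: bounded_mfunM|]; auto.
  rewrite dcc// dss// -mulrBl; congr ((_ - _) * _).
    by have [] := decouples_recr dc bcos.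
  by have [] := decouples_recr ds bsin.
- move=> h bh; rewrite Es.
  have [_ dcs] := decouples_recr dc bsin; have [_ dsc] := decouples_recr ds bcos.
  under eq_Ex do rewrite sinD mulrDl.
  rewrite ExD; last 2 first.
  - by apply: bounded_mfunM; [apply: bounded_mfunM|]; auto.
  - by apply: bounded_mfunM; [apply: bounded_mfunM|]; auto.
  rewrite dcs// dsc// -mulrDl; congr ((_ + _) * _).
    by have [] := decouples_recr ds bcos.
  by have [] := decouples_recr dc bsin.
congr charmod; apply/funext => w.
by rewrite big_ord_recr/= [in LHS](addrC (\sum_(_ < _) _)) addrA.
Qed.

Lemma charmod_sum_independent n (Z : nat -> T -> R) (c : nat -> R) :
  (forall i, measurable_fun setT (Z i)) ->
  mutually_independent P (fun i : 'I_n => Z i) ->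
  charmod (fun w => \sum_(i < n) c i * Z i w) =
  \prod_(i < n) charmod (fun w => c i * Z i w).
Proof.
move=> mZ indZ.
have mcZ i : measurable_fun setT (fun w => c i * Z i w).
  by apply: measurable_funM.
(* The induction starts at V = 0, whose cosine and sine are constants. *)
have dec (k : R) : decouples n (fun=> k) (fun i w => c i * Z i w).
  move=> h bh; rewrite ExZ; last first.
    by apply: bounded_mfun_prod => i; exact: (bounded_mfun_comp (bh i)).
  rewrite Ex_cst; congr (_ * _).
  apply: (@Ex_prod_independent _ (fun i : 'I_n => Z i) _ indZ
           (fun i x => h i (c i * x))) => // i.
  exact: (bounded_mfun_comp (bh i)).
have := @charmod_sum n (fun=> 0) _ (measurable_cst _) mcZ (dec _) (dec _).
rewrite {2}/charmod cos0 sin0 !Ex_cst expr1n expr0n addr0 mul1r => <-.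
by congr charmod; apply/funext => w; rewrite add0r.
Qed.

End independence.

(** * Levy processes *)

Section levy.
Context {d : measure_display} {T : measurableType d} {R : realType}.
Variables (P : probability T R) (Lp : R -> T -> R).
Hypothesis levyL : levy_process P Lp.
Local Notation charmod := (charmod P).

Lemma levy_measurable t : 0 <= t -> measurable_fun setT (Lp t).
Proof. by case: levyL => h _ _ _ _; exact: h. Qed.

Lemma levy_charmod_increment c s t : 0 <= s -> s <= t ->
  charmod (fun w => c * (Lp t w - Lp s w)) = charmod (fun w => c * Lp (t - s) w).
Proof.
move=> s0 st; have t0 := le_trans s0 st.
have [mL _ _ stat _] := levyL.
apply: charmod_same_law.
- by apply: measurable_funM => //; apply: measurable_funB; exact: mL.
- by apply: measurable_funM => //; apply: mL; rewrite subr_ge0.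
- move=> B mB; apply: (stat s t s0 st [set x | B (c * x)]).
  rewrite -[X in measurable X]setTI.
  by apply: (measurable_funM (measurable_cst c) (@measurable_id _ _ _)).
Qed.

Lemma levy_charmodD c s t : 0 < s -> 0 < t ->
  charmod (fun w => c * Lp (s + t) w) =
  charmod (fun w => c * Lp s w) * charmod (fun w => c * Lp t w).
Proof.
move=> s0 t0; have [mL _ ind _ _] := levyL.
pose tau (i : nat) := match i with 0%N => 0 | 1%N => s | _ => s + t end.
have st0 : 0 < s + t by exact: addr_gt0.
have tau0 i : 0 <= tau i by case: i => [|[|i]]//=; exact: ltW.
have mZ i : measurable_fun setT (fun w => Lp (tau i.+1) w - Lp (tau i) w).
  by apply: measurable_funB; exact: mL.
have tauS i : (i < 2)%N -> tau i < tau i.+1 by case: i => [|[|i]]//= _; rewrite ltrDl.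
have := @charmod_sum_independent _ _ _ P 2%N _ (fun=> c) mZ (ind _ _ (tau0 0%N) tauS).
rewrite big_ord_recr big_ord1/= => h.
rewrite -[in LHS](subr0 (s + t)) -levy_charmod_increment ?(ltW st0)//.
rewrite -[X in _ = charmod (fun w => c * Lp X w) * _]subr0 -levy_charmod_increment ?(ltW s0)//.
rewrite -[X in _ = _ * charmod (fun w => c * Lp X w)](addrK s) (addrC t).
rewrite -levy_charmod_increment ?(ltW s0) ?lerDl ?(ltW t0)//.
rewrite -h.
congr charmod; apply/funext => w; rewrite big_ord_recr big_ord1/=; ring.
Qed.

(** The modulus m(t) is multiplicative in t and at most 1. It never vanishes, since a zero at s
    would spread to all later times while m is positive at positive integers. Thus -ln m is additive
    and nonnegative, hence linear. *)
Lemma levy_charmod_expR c q : charmod (fun w => c * Lp 1 w) = expR (- (2 * q)) ->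
  forall t, 0 <= t -> charmod (fun w => c * Lp t w) = expR (- (2 * (t * q))).
Proof.
move=> h1 t; rewrite le_eqVlt => /predU1P[<-|t0].
  have := @levy_charmod_increment c 0 0 (lexx 0) (lexx 0); rewrite subr0 => <-.
  rewrite mul0r mulr0 oppr0 expR0.
  rewrite (_ : (fun w => _) = (fun=> 0)); last by apply/funext => w; rewrite subrr mulr0.
  by rewrite /charmod cos0 sin0 !Ex_cst expr1n expr0n addr0.
pose m t := charmod (fun w => c * Lp t w).
have mD s u : 0 < s -> 0 < u -> m (s + u) = m s * m u by exact: levy_charmodD.
have m0 s : 0 <= m s by exact: charmod_ge0.
have mn n : 0 < m n.+1%:R.
  elim: n => [|n IH]; first by rewrite /m h1 expR_gt0.
  by rewrite -natr1 mD// mulr_gt0// /m h1 expR_gt0.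
have mp s : 0 < s -> 0 < m s.
  move=> s0; have [n sn] : exists n, s < n.+1%:R.
    by exists (Num.truncn s); rewrite truncnS_gt.
  rewrite lt_neqAle m0 andbT eq_sym; apply/eqP => ms0.
  by have := mn n; rewrite -(subrK s n.+1%:R) mD ?subr_gt0// ms0 mulr0 ltxx.
have := @additive_ge0_linear _ (fun s => - ln (m s)) _ _ t t0.
have -> : m 1 = expR (- (2 * q)) := h1.
rewrite expRK opprK => h.
rewrite -[LHS]lnK ?posrE ?mp//; congr expR; apply/eqP; rewrite -eqr_oppLR; apply/eqP.
rewrite -/(m t) h; first by ring.
  by move=> s u s0 u0; rewrite mD// lnM ?posrE ?mp// opprD.
move=> s s0; rewrite oppr_ge0 ln_le0//; apply: charmod_le1.
apply: measurable_funM => //; apply: levy_measurable; exact: ltW.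
Qed.

Lemma levy_charmod_grid (q : R -> R) n (s c : nat -> R) :
  (forall u, charmod (fun w => u * Lp 1 w) = expR (- (2 * q u))) ->
  (forall i, 0 <= s i) -> (forall i, (i < n)%N -> s i < s i.+1) ->
  charmod (fun w => \sum_(i < n) c i * (Lp (s i.+1) w - Lp (s i) w)) =
  expR (- (2 * \sum_(i < n) (s i.+1 - s i) * q (c i))).
Proof.
move=> hq s0 sS; have [mL _ ind _ _] := levyL.
have mZ i : measurable_fun setT (fun w => Lp (s i.+1) w - Lp (s i) w).
  by apply: measurable_funB; exact: mL.
rewrite (@charmod_sum_independent _ _ _ P n _ c mZ (ind _ _ (s0 _) sS)).
rewrite mulr_sumr -sumrN (big_morph expR (@expRD R) (@expR0 R)).
apply: eq_bigr => i _.
rewrite levy_charmod_increment ?(ltW (sS _ _))// (levy_charmod_expR (hq _))//.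
by rewrite subr_ge0 ltW// sS.
Qed.

End levy.

(** * Step functions on a grid *)

Section grid.
Context {R : realType}.
Implicit Types (t : nat -> R) (phi : seq (R * R * R)).

Definition increasing_upto n t := forall i, (i < n)%N -> t i < t i.+1.

Lemma increasing_upto_lt n t : increasing_upto n t ->
  forall i j, (i <= n)%N -> (j <= n)%N -> (t i < t j) = (i < j)%N.
Proof.
move=> tS.
have homo i j : (i < j)%N -> (j <= n)%N -> t i < t j.
  elim: j => // j IH; rewrite ltnS leq_eqVlt => /predU1P[->|ij] jn; first exact: tS.
  by rewrite (lt_trans (IH ij (ltnW jn)))// tS.
move=> i j ni nj; have [ij|ji|->] := ltngtP i j; last by rewrite ltxx.
  exact: homo.
by apply/negbTE; rewrite -leNgt ltW// homo.
Qed.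

Lemma increasing_upto_le n t : increasing_upto n t ->
  forall i j, (i <= n)%N -> (j <= n)%N -> (t i <= t j) = (i <= j)%N.
Proof. by move=> tS i j ni nj; rewrite leNgt (increasing_upto_lt tS)// -leqNgt. Qed.

Definition on_grid n t x := exists2 i, (i <= n)%N & t i = x.

Lemma grid_exists (s : seq R) : exists n t,
  increasing_upto n t /\ forall x, x \in s -> on_grid n t x.
Proof.
case: s => [|x0 s]; first by exists 0%N, (fun=> 0); split.
set s' := x0 :: s.
pose l := sort <=%R (undup s'); exists (size l).-1, (nth 0 l).
have sl : sorted <%R l by rewrite sort_lt_sorted undup_uniq.
have inl x : x \in s' -> x \in l by rewrite mem_sort mem_undup.
have l0 : (0 < size l)%N.
  by rewrite -has_predT; apply/hasP; exists x0 => //; rewrite inl// mem_head.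
split => [i il|x /inl xl].
  apply: (sorted_ltn_nth lt_trans) => //; rewrite inE; last by rewrite -ltn_predRL.
  by rewrite (leq_trans il)// leq_pred.
exists (index x l); last by rewrite nth_index.
by rewrite -ltnS prednK// index_mem.
Qed.

Lemma telescope_window (G : nat -> R) n i j : (i <= j)%N -> (j <= n)%N ->
  \sum_(k < n) (if (i <= k < j)%N then G k.+1 - G k else 0) = G j - G i.
Proof.
move=> ij jn; rewrite -(telescope_sumr _ ij).
rewrite -(big_mkord xpredT (fun k => if (i <= k < j)%N then G k.+1 - G k else 0)).
rewrite (big_cat_nat (n := i))//=; last exact: leq_trans jn.
rewrite (big_cat_nat (n := j) (m := i))//=.
rewrite big_nat big1 ?add0r; last first.
  by move=> k /andP[_ ki]; rewrite leqNgt ki.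
rewrite [X in _ + X]big_nat [X in _ + X]big1 ?addr0; last first.
  by move=> k /andP[jk _]; rewrite ltnNge jk andbF.
by apply: eq_big_nat => k ->.
Qed.

Definition endpoints phi : seq R := flatten [seq [:: p.1.2; p.2] | p <- phi].

Lemma endpointsP phi p : p \in phi -> p.1.2 \in endpoints phi /\ p.2 \in endpoints phi.
Proof.
by move=> pphi; split; apply/flattenP; exists [:: p.1.2; p.2];
  rewrite ?mem_head ?in_cons ?eqxx ?orbT//; apply/mapP; exists p.
Qed.

(** The intervals of [phi] may overlap; regrouping by grid cells gives disjoint increments, to which
    independence applies. The coefficient is read at the right end of the cell because the intervals
    are of the form (a, b]. *)
Lemma step_sum_grid (F : R -> R) phi n t : increasing_upto n t ->
  (forall x, x \in endpoints phi -> on_grid n t x) ->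
  \sum_(p <- phi) p.1.1 * (if p.1.2 < p.2 then F p.2 - F p.1.2 else 0) =
  \sum_(k < n) stepfun phi (t k.+1) * (F (t k.+1) - F (t k)).
Proof.
move=> tS hg; rewrite /stepfun.
under [RHS]eq_bigr do rewrite mulr_suml.
rewrite exchange_big/=; apply: eq_big_seq => p pphi.
have [/hg[i ni <-] /hg[j nj <-]] := endpointsP pphi.
under [RHS]eq_bigr do rewrite -mulrA; rewrite -mulr_sumr; congr (_ * _).
rewrite (increasing_upto_lt tS)//.
transitivity (\sum_(k < n) (if (i <= k < j)%N then F (t k.+1) - F (t k) else 0)).
  have [ij|ji] := ltnP i j.
    by rewrite (telescope_window (fun k => F (t k)))// ltnW.
  rewrite big1// => k _; case: ifPn => // /andP[ik kj].
  by have := leq_ltn_trans ik (leq_trans kj ji); rewrite ltnn.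
apply: eq_bigr => k _; rewrite (increasing_upto_lt tS)// (increasing_upto_le tS)// ltnS.
by case: ifPn => _; rewrite ?mul1r ?mul0r.
Qed.

(** A step function is constant on each cell, so composing it with any q gives a combination of
    indicators; off the grid it is 0, which is where q 0 = 0 enters. *)
Lemma stepfun_grid (q : R -> R) phi n t x : increasing_upto n t ->
  (forall x, x \in endpoints phi -> on_grid n t x) -> q 0 = 0 ->
  q (stepfun phi x) = \sum_(k < n) q (stepfun phi (t k.+1)) * \1_(`]t k, t k.+1]) x.
Proof.
move=> tS hg q0.
have lt := increasing_upto_lt tS; have le := increasing_upto_le tS.
have [[k kx]|nk] := pselect (exists k : 'I_n, t k < x <= t k.+1).
  have -> : stepfun phi x = stepfun phi (t k.+1).
    apply: eq_big_seq => p pphi.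
    have [/hg[i ni <-] /hg[j nj <-]] := endpointsP pphi.
    move/andP: kx => [kx xk]; have kn := ltn_ord k.
    have -> : (t i < x) = (t i < t k.+1).
      apply/idP/idP => [/lt_le_trans|]; first exact.
      by rewrite lt// ltnS => ik; rewrite (le_lt_trans _ kx)// le// ltnW.
    have -> // : (x <= t j) = (t k.+1 <= t j).
    apply/idP/idP => [xj|/(le_trans xk)//].
    by have := lt_le_trans kx xj; rewrite lt ?(ltnW kn)// le.
  rewrite (bigD1 k)//= big1 ?addr0; last first.
    move=> k' kk'; rewrite indicE memNset ?mulr0//= in_itv/=.
    move: kx => /andP[kx xk] /andP[k'x xk'].
    move/eqP : kk'; apply; apply/val_inj/eqP; rewrite /= eqn_leq.
    have k'k : (k' < k.+1)%N by rewrite -lt ?(ltnW (ltn_ord k'))// (lt_le_trans k'x).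
    have kk' : (k < k'.+1)%N by rewrite -lt ?(ltnW (ltn_ord k))// (lt_le_trans kx).
    by rewrite -ltnS k'k -ltnS.
  by rewrite indicE mem_set ?mulr1//= in_itv.
rewrite big1; last first.
  move=> k _; rewrite indicE memNset ?mulr0//= in_itv/= => kx.
  by apply: nk; exists k.
rewrite /stepfun big1_seq// => p /andP[_ pphi].
have [/hg[i ni <-] /hg[j nj <-]] := endpointsP pphi.
case: ifPn => [/andP[ix xj]|_]; last by rewrite mulr0.
exfalso; apply: nk.
(* The least such index closes the cell containing x; it is not 0 because t i < x. *)
have ex : exists k, (x <= t k) && (k <= n)%N by exists j; rewrite xj.
case: (ex_minnP ex) => -[|k] /andP[xk kn] kmin.
  by have := lt_le_trans ix xk; rewrite lt.
exists (Ordinal kn) => /=; rewrite xk andbT ltNge; apply/negP => xk'.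
by have := kmin k; rewrite xk' (ltnW kn) ltnn => /(_ isT).
Qed.

Lemma integrable_stepfun (q : R -> R) phi : q 0 = 0 ->
  lebesgue_measure.-integrable setT (EFin \o (fun x => q (stepfun phi x))).
Proof.
move=> q0; have [n [t [tS hg]]] := grid_exists (endpoints phi).
rewrite /comp; under eq_fun do rewrite (stepfun_grid _ tS hg q0) -sumEFin.
apply: (integrable_sum measurableT) => k _.
under eq_fun do rewrite EFinM; apply: integrableZl => //.
by have := @integrable_indic_itv R (t k) (t k.+1) false false.
Qed.

Lemma measurable_stepfun phi : measurable_fun setT (stepfun phi).
Proof.
by have /measurable_int/measurable_EFinP := @integrable_stepfun id phi erefl.
Qed.

Lemma integral_stepfun_grid (q : R -> R) phi n t : increasing_upto n t ->
  (forall x, x \in endpoints phi -> on_grid n t x) -> q 0 = 0 ->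
  Rintegral lebesgue_measure setT (fun x => q (stepfun phi x)) =
  \sum_(k < n) (t k.+1 - t k) * q (stepfun phi (t k.+1)).
Proof.
move=> tS hg q0.
rewrite /Rintegral; under eq_integral do rewrite (stepfun_grid _ tS hg q0) -sumEFin.
have ii (k : 'I_n) : lebesgue_measure.-integrable setT
    (fun x => (q (stepfun phi (t k.+1)) * \1_(`]t k, t k.+1]) x)%:E).
  under eq_fun do rewrite EFinM; apply: integrableZl => //.
  by have := @integrable_indic_itv R (t k) (t k.+1) false false.
rewrite integral_sum// -[RHS]/(fine _%:E) -sumEFin; congr fine.
apply: eq_bigr => k _; under eq_integral do rewrite EFinM.
rewrite integralZl//; last by have := @integrable_indic_itv R (t k) (t k.+1) false false.
rewrite integral_indic// setIT.
rewrite [X in (_ * X)%E](_ : _ = (t k.+1 - t k)%:E); first by rewrite -EFinM mulrC.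
apply: etrans; first exact: (lebesgue_measure_itv `]t k, t k.+1]).
by rewrite /= lte_fin tS.
Qed.

End grid.

(** * Integrals of nonmeasurable functions, and absence of fixed jumps *)

Section versions.
Context {d : measure_display} {T : measurableType d} {R : realType}.
Variable (P : probability T R).

(** The integral of a nonnegative function is a supremum over simple functions below it, so it is
    monotone whether or not the integrands are measurable. *)
Lemma le_integralT_nonmeasurable (mu : {measure set T -> \bar R}) (f g : T -> \bar R) :
  (forall x, 0 <= f x)%E -> (forall x, f x <= g x)%E ->
  (\int[mu]_x f x <= \int[mu]_x g x)%E.
Proof.
move=> f0 fg; have g0 x : (0 <= g x)%E by exact: le_trans (f0 x) (fg x).
rewrite !ge0_integralTE//; apply: ereal_sup_le => _ [h hf <-].
by exists h => // x; exact: le_trans (hf x) (fg x).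
Qed.

(** Off a null set containing the exceptional points, g restricted to the complement lies below f
    everywhere. This direction carries convergence to 0 over from a possibly nonmeasurable f to its
    measurable version g. *)
Lemma ae_ge0_le_integral_nonmeasurable (mu : {measure set T -> \bar R})
  (f g : T -> \bar R) :
  (forall x, 0 <= f x)%E -> (forall x, 0 <= g x)%E -> measurable_fun setT g ->
  {ae mu, forall x, f x = g x} -> (\int[mu]_x g x <= \int[mu]_x f x)%E.
Proof.
move=> f0 g0 mg [N [mN N0 fgN]].
rewrite (@ge0_negligible_integral _ _ _ mu setT N)// setTD.
rewrite (@eq_integral _ _ _ mu _ f); last first.
  move=> x; rewrite inE => /= Nx; apply: contrapT => fgx.
  by apply: Nx; apply: fgN => /= /esym.
rewrite integral_mkcond; apply: le_integralT_nonmeasurable.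
  by move=> x; apply: erestrict_ge0 => ? _; exact: f0.
by move=> x; rewrite /patch; case: ifP.
Qed.

(** This is x^2/(1 + x^2): bounded, continuous and zero only at 0, so its expectation detects
    convergence to 0 in probability. *)
Definition bounded_size (x : R) : R := 1 - (1 + x ^+ 2)^-1.

Lemma bounded_size_ge0 x : 0 <= bounded_size x.
Proof. by rewrite subr_ge0 invf_le1 ?ltr_wpDr ?lerDl ?sqr_ge0. Qed.

Lemma bounded_size_le1 x : bounded_size x <= 1.
Proof. by rewrite gerBl invr_ge0 addr_ge0// sqr_ge0. Qed.

Lemma bounded_size_eq0 x : bounded_size x = 0 -> x = 0.
Proof.
move/subr0_eq => /(congr1 GRing.inv); rewrite invrK invr1 => h.
by apply/eqP; rewrite -sqrf_eq0; apply/eqP; lra.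
Qed.

Lemma continuous_bounded_size : continuous bounded_size.
Proof.
move=> x; apply: cvgB; first exact: cvg_cst.
exact: continuous_oneDsqrV.
Qed.

Lemma cvg_bounded_size (u : nat -> R) l : u @ \oo --> l ->
  (fun n => bounded_size (u n)) @ \oo --> bounded_size l.
Proof. by move=> ul; apply: continuous_cvg => //; exact: continuous_bounded_size. Qed.

Lemma measurable_bounded_size : measurable_fun setT bounded_size.
Proof. by apply: continuous_measurable_fun; exact: continuous_bounded_size. Qed.

Lemma levy_start0 (Lp : R -> T -> R) : levy_process P Lp -> {ae P, forall w, Lp 0 w = 0}.
Proof.
move=> [mL L0 _ _ _].
have m0 : measurable [set w | Lp 0 w = 0].
  by rewrite -[X in measurable X]setTI; exact: (mL 0 (lexx 0) measurableT [set 0]).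
exists (~` [set w | Lp 0 w = 0]); split => //; first exact: measurableC.
by rewrite probability_setC ?L0 ?subee.
Qed.

(** By stationarity the increment over [t - h, t] has the law of [Lp h], which tends to 0 by right
    continuity at 0. So the expected [bounded_size] of these increments tends to 0, and Fatou's
    lemma forces the jump at t to vanish almost surely. *)
Lemma levy_no_fixed_jump (Lp : R -> T -> R) t : levy_process P Lp -> 0 < t ->
  {ae P, forall w, lim ((fun x => Lp x w) @ t^'-) = Lp t w}.
Proof.
move=> levyL t0; have ae0 := levy_start0 levyL.
have [mL _ _ stat cad] := levyL.
(* The shift to n.+2 keeps h n < t, so t - h n is a positive time. *)
pose h n : R := t / n.+2%:R.
have h0 n : 0 < h n by rewrite divr_gt0.
have ht n : h n < t by rewrite ltr_pdivrMr// ltr_pMr// ltr1n.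
have hcvg : h @ \oo --> 0.
  rewrite -(mulr0 t); apply: cvgM; first exact: cvg_cst.
  by have := @cvg_harmonic R; rewrite -cvg_shiftS.
pose D n w := Lp t w - Lp (t - h n) w.
have th0 n : 0 <= t - h n by rewrite subr_ge0 ltW.
have mD n : measurable_fun setT (D n).
  by apply: measurable_funB; apply: mL => //; exact: ltW.
have mLh n : measurable_fun setT (Lp (h n)) by apply/mL/ltW.
have bb : bounded_mfun bounded_size.
  split; first exact: measurable_bounded_size.
  by exists 1 => x; rewrite ger0_norm ?bounded_size_ge0// bounded_size_le1.
have law n : (\int[P]_w (bounded_size (D n w))%:E =
              \int[P]_w (bounded_size (Lp (h n) w))%:E)%E.
  rewrite !ExE; [|exact: (bounded_mfun_comp bb)|exact: (bounded_mfun_comp bb)].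
  congr EFin; apply: Ex_same_law => // B mB.
  have tE : t - (t - h n) = h n by ring.
  by rewrite stat ?tE// lerBlDr lerDl (ltW (h0 n)).
have lim0 : (fun n => \int[P]_w (bounded_size (D n w))%:E)%E @ \oo --> 0%E.
  under eq_fun do rewrite law.
  have [|||||_ _] := @dominated_convergence _ _ _ P setT measurableT
    (fun n w => (bounded_size (Lp (h n) w))%:E) (cst 0%E) (cst 1%E).
  - move=> n; apply/measurable_EFinP; apply: measurableT_comp => //.
    exact: measurable_bounded_size.
  - exact: measurable_cst.
  - apply: filterS2 ae0 cad => w w0 [rc _] _.
    apply: cvg_EFin; first by near=> n.
    rewrite (_ : 0 = bounded_size (Lp 0 w)); last first.
      by rewrite w0 /bounded_size expr0n addr0 invr1 subrr.
    apply: cvg_bounded_size.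
    by have /cvg_at_rightP := rc 0 (lexx 0); apply; split.
  - exact: finite_measure_integrable_cst.
  - by apply: nearW => w n _; rewrite /= lee_fin ger0_norm ?bounded_size_ge0// bounded_size_le1.
  by rewrite integral0.
(* The lower limit is measurable and defined for all w, whereas the left limit is known to exist
   only almost surely. *)
pose li w := limn_einf (fun n => (bounded_size (D n w))%:E).
have mbD n : measurable_fun setT (fun w => (bounded_size (D n w))%:E).
  by apply/measurable_EFinP; apply: measurableT_comp => //; exact: measurable_bounded_size.
have mli : measurable_fun setT li.
  rewrite (_ : li = fun w => (- limn_esup (fun n => - (bounded_size (D n w))%:E))%E).
    apply: measurableT_comp => //; apply: measurable_fun_limn_esup => n.
    exact: measurableT_comp.
  apply/funext => w; rewrite -limn_einfN; congr limn_einf.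
  by apply/funext => n; rewrite [RHS]oppeK.
have li0 w : (0 <= li w)%E.
  rewrite /li limn_einf_lim; apply: lime_ge.
    apply: ereal_nondecreasing_is_cvgn; exact: nondecreasing_einfs.
  apply: nearW => n; apply: le_ereal_inf_tmp => _ [k _ <-].
  by rewrite lee_fin bounded_size_ge0.
have : (\int[P]_w `|li w| = 0)%E.
  under eq_integral do rewrite gee0_abs//.
  apply/eqP; rewrite eq_le integral_ge0 ?andbT//.
  apply: (le_trans (fatou _ _ _ _)) => //.
    by move=> n w _; rewrite lee_fin bounded_size_ge0.
  by rewrite is_cvg_limn_einfE ?(cvg_lim _ lim0)//; apply/cvg_ex; exists 0%E.
move=> /(ae_eq_integral_abs _ measurableT mli) liae.
apply: filterS2 liae cad => w /(_ Logic.I) wli [_ /(_ t t0) lc].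
have ll := lc; set l := lim _.
have Dl : (fun n => D n w) @ \oo --> Lp t w - l.
  apply: cvgB; first exact: cvg_cst.
  have /cvg_at_leftP : (fun x => Lp x w) @ t^'- --> l by exact: ll.
  apply; split => [n|]; first by rewrite ltrBlDr ltrDl.
  by rewrite -[X in _ --> X]subr0; apply: cvgB => //; exact: cvg_cst.
have liml : (fun n => (bounded_size (D n w))%:E) @ \oo --> (bounded_size (Lp t w - l))%:E.
  by apply: cvg_EFin; [near=> n|exact: (cvg_bounded_size Dl)].
move: wli; rewrite /li is_cvg_limn_einfE; last by apply/cvg_ex; eexists; exact: liml.
rewrite (cvg_lim _ liml)// => -[] /bounded_size_eq0 /eqP.
by rewrite subr_eq0 => /eqP.
Unshelve. all: by end_near. Qed.

End versions.

(** * The two-sided process *)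

Section two_sided_charmod.
Context {d : measure_display} {T : measurableType d} {R : realType}.
Variables (P : probability T R) (L1 L2 : R -> T -> R).
Hypotheses (levy1 : levy_process P L1) (levy2 : levy_process P L2).

(* [two_sided L1 L2] takes left limits at negative times and need not be
   measurable; this version is, and agrees with it almost surely. *)
Definition two_sided_version (t : R) (w : T) : R :=
  if 0 <= t then L1 t w - L1 0 w else - (L2 (- t) w - L2 0 w).
Local Notation L := two_sided_version.

(** Both branches subtract the value at 0, which is zero only almost surely; they therefore meet
    exactly at t = 0 for every w. *)
Lemma two_sided_version_le0 t w : t <= 0 -> L t w = - (L2 (- t) w - L2 0 w).
Proof.
rewrite /L le_eqVlt => /predU1P[->|t0]; first by rewrite lexx oppr0 !subrr oppr0.
by rewrite leNgt t0.
Qed.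

Lemma two_sided_version_measurable t : measurable_fun setT (L t).
Proof.
rewrite /L; case: (leP 0 t) => t0.
  by apply: measurable_funB; apply: (levy_measurable levy1).
apply: measurableT_comp => //.
by apply: measurable_funB; apply: (levy_measurable levy2); rewrite // oppr_ge0 ltW.
Qed.

Lemma two_sided_ae t : {ae P, forall w, two_sided L1 L2 t w = L t w}.
Proof.
rewrite /two_sided /L; case: (leP 0 t) => t0.
  by apply: filterS (levy_start0 levy1) => w ->; rewrite subr0.
have mt0 : 0 < - t by rewrite oppr_gt0.
apply: filterS2 (levy_start0 levy2) (levy_no_fixed_jump levy2 mt0) => w -> ->.
by rewrite subr0.
Qed.

Lemma step_integral_ae phi :
  {ae P, forall w, step_integral (two_sided L1 L2) phi w = step_integral L phi w}.
Proof.
elim: phi => [|p phi IH].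
  by apply: nearW => w; rewrite /step_integral !big_nil.
apply: filterS3 IH (two_sided_ae p.2) (two_sided_ae p.1.2) => w h h2 h1.
by move: h; rewrite /step_integral !big_cons => ->; rewrite h1 h2.
Qed.

Lemma step_integral_measurable phi : measurable_fun setT (step_integral L phi).
Proof.
rewrite /step_integral; elim: phi => [|p phi IH].
  by under eq_fun do rewrite big_nil; exact: measurable_cst.
under eq_fun do rewrite big_cons; apply: measurable_funD => //.
apply: measurable_funM => //; case: (p.1.2 < p.2) => //.
by apply: measurable_funB; exact: two_sided_version_measurable.
Qed.

Lemma is_stoch_integral_version f Z : is_stoch_integral P (two_sided L1 L2) f Z ->
  is_stoch_integral P L f Z.
Proof.
move=> [mZ [phi [phif phiZ]]]; split => //; exists phi; split => //.
apply: (squeeze_cvge _ (cvg_cst 0%E) phiZ); apply: nearW => m.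
rewrite integral_ge0/=; last by move=> w _; rewrite lee_fin exprn_ge0.
apply: ae_ge0_le_integral_nonmeasurable.
- by move=> w; rewrite lee_fin exprn_ge0.
- by move=> w; rewrite lee_fin exprn_ge0.
- apply/measurable_EFinP; apply: measurable_funX; apply: measurableT_comp => //.
  by apply: measurable_funB => //; exact: step_integral_measurable.
- by apply: filterS (step_integral_ae (phi m)) => w ->.
Qed.

(** Independence of the two processes is stated for vectors of their values, so weighted increments
    are put in the form of a measurable function of such a vector. *)
Lemma increments_rvec (Lp : R -> T -> R) r (s c : nat -> R) : (forall i, 0 <= s i) ->
  exists (ts : r.+1.-tuple R) (G : r.+1.-tuple R -> R),
  [/\ forall i, 0 <= tnth ts i, measurable_fun setT G &
      forall w, \sum_(i < r) c i * (Lp (s i.+1) w - Lp (s i) w) = G (rvec Lp ts w)].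
Proof.
move=> s0; exists [tuple s i | i < r.+1], (fun v => \sum_(i < r) c i *
  (tnth v (inord i.+1) - tnth v (inord i))); split.
- by move=> i; rewrite tnth_mktuple.
- apply: measurable_sum => i; apply: measurable_funM => //.
  by apply: measurable_funB; exact: measurable_tnth.
- move=> w; apply: eq_bigr => i _; rewrite /rvec !tnth_map !tnth_ord_tuple.
  by rewrite !inordK// ltnS// ltnW.
Qed.

Hypothesis ind12 : independent_processes P L1 L2.
Variable q : R -> R.
Hypothesis q1 : forall u, charmod P (fun w => u * L1 1 w) = expR (- (2 * q u)).
Hypothesis q2 : forall u, charmod P (fun w => u * L2 1 w) = expR (- (2 * q u)).

(** With 0 among the grid points no cell straddles the origin. Cells on the left are reflected into
    cells for L2, where the sign of the process and the reversal of time cancel, and the two halves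
    are independent. *)
Lemma charmod_two_sided_grid n p (t c : nat -> R) : increasing_upto n t ->
  (p <= n)%N -> t p = 0 ->
  charmod P (fun w => \sum_(k < n) c k * (L (t k.+1) w - L (t k) w)) =
  expR (- (2 * \sum_(k < n) (t k.+1 - t k) * q (c k))).
Proof.
move=> tS pn tp; have le := increasing_upto_le tS.
pose r := (n - p)%N; have nE : n = (p + r)%N by rewrite subnKC.
(* Truncated subtraction here, and [minn] in [s1], keep the times nonnegative for all j, beyond the
   cells that are summed. *)
pose s2 j := - t (p - j)%N.
pose s1 j := t (p + minn j r)%N.
have s20 j : 0 <= s2 j by rewrite oppr_ge0 -tp le ?leq_subr// (leq_trans (leq_subr _ _)).
have s10 j : 0 <= s1 j by rewrite -tp le ?leq_addr// nE leq_add2l geq_minr.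
have s2S j : (j < p)%N -> s2 j < s2 j.+1.
  move=> jp; rewrite ltrN2 (increasing_upto_lt tS) ?(leq_trans (leq_subr _ _))//.
  by rewrite ltn_sub2l.
have s1S j : (j < r)%N -> s1 j < s1 j.+1.
  move=> jr; rewrite (increasing_upto_lt tS) ?nE ?leq_add2l ?geq_minr//.
  by rewrite ltn_add2l (minn_idPl jr) (minn_idPl (ltnW jr)).
pose c2 j := c (p - j.+1)%N; pose c1 j := c (p + j)%N.
pose U2 w := \sum_(j < p) c2 j * (L2 (s2 j.+1) w - L2 (s2 j) w).
pose U1 w := \sum_(j < r) c1 j * (L1 (s1 j.+1) w - L1 (s1 j) w).
have sumE (F : nat -> R) : \sum_(k < n) F k =
    \sum_(j < p) F (p - j.+1)%N + \sum_(j < r) F (p + j)%N.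
  rewrite nE big_split_ord/=; congr (_ + _).
  by rewrite (reindex_inj rev_ord_inj).
have UE w : \sum_(k < n) c k * (L (t k.+1) w - L (t k) w) = U2 w + U1 w.
  rewrite (sumE (fun k => c k * (L (t k.+1) w - L (t k) w))).
  congr (_ + _); apply: eq_bigr => j _; congr (_ * _).
    have jp := ltn_ord j; rewrite !two_sided_version_le0; last 2 first.
    - by rewrite -tp le// (leq_trans (leq_subr _ _)).
    - by rewrite -tp le// ?(leq_trans _ pn)// subnSK// leq_subr.
    by rewrite /s2 subnSK//; ring.
  have jr := ltn_ord j.
  have h0 i : (i <= r)%N -> 0 <= t (p + i)%N by move=> ir; rewrite -tp le ?leq_addr// nE leq_add2l.
  rewrite /L -addnS !h0 ?(ltnW jr)// /s1 (minn_idPl jr) (minn_idPl (ltnW jr)); ring.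
have [ts1 [G1 [ts10 mG1 U1E]]] := @increments_rvec L1 r s1 c1 s10.
have [ts2 [G2 [ts20 mG2 U2E]]] := @increments_rvec L2 p s2 c2 s20.
have mU1 : measurable_fun setT U1.
  apply: measurable_sum => i; apply: measurable_funM => //.
  by apply: measurable_funB; exact: (levy_measurable levy1).
have mU2 : measurable_fun setT U2.
  apply: measurable_sum => i; apply: measurable_funM => //.
  by apply: measurable_funB; exact: (levy_measurable levy2).
have dec : decouple P U2 U1.
  move=> f g hf bg; rewrite mulrC; under eq_Ex do rewrite mulrC.
  apply: Ex_prod_independent2 => //; last first.
    by case: hf => ->; [exact: bounded_mfun_cos|exact: bounded_mfun_sin].
  move=> A B mA mB.
  have := @ind12 _ _ ts1 ts2 ts10 ts20 (G1 @^-1` A) (G2 @^-1` B).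
  rewrite -(setTI (G1 @^-1` A)) -(setTI (G2 @^-1` B)).
  move=> /(_ (mG1 measurableT _ mA) (mG2 measurableT _ mB)); rewrite !setTI /preimage/=.
  have E1 w : U1 w = G1 (rvec L1 ts1 w) := U1E w.
  have E2 w : U2 w = G2 (rvec L2 ts2 w) := U2E w.
  rewrite (_ : [set w | A (U1 w) /\ B (U2 w)] =
     [set w | A (G1 (rvec L1 ts1 w)) /\ B (G2 (rvec L2 ts2 w))]); last first.
    by apply/seteqP; split => w /=; rewrite E1 E2.
  rewrite (_ : [set w | A (U1 w)] = [set w | A (G1 (rvec L1 ts1 w))]); last first.
    by apply/seteqP; split => w /=; rewrite E1.
  rewrite (_ : [set w | B (U2 w)] = [set w | B (G2 (rvec L2 ts2 w))])//.
  by apply/seteqP; split => w /=; rewrite E2.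
rewrite (_ : (fun w => _) = (fun w => U2 w + U1 w)); last exact/funext.
rewrite charmodD// (levy_charmod_grid levy1 _ q1)// (levy_charmod_grid levy2 _ q2)//.
rewrite -expRD -opprD -mulrDr; congr (expR (- (2 * _))).
rewrite (sumE (fun k => (t k.+1 - t k) * q (c k))); congr (_ + _); apply: eq_bigr => j _.
  by rewrite /s2 /c2 subnSK//; congr (_ * _); ring.
have jr := ltn_ord j.
by rewrite /s1 (minn_idPl jr) (minn_idPl (ltnW jr)) addnS.
Qed.

Lemma charmod_step_integral phi : q 0 = 0 ->
  charmod P (step_integral L phi) =
  expR (- (2 * Rintegral lebesgue_measure setT (fun s => q (stepfun phi s)))).
Proof.
move=> q0; have [n [t [tS tg]]] := grid_exists (0 :: endpoints phi).
have [p pn tp] := tg 0 (mem_head _ _).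
have te x : x \in endpoints phi -> on_grid n t x.
  by move=> xe; apply: tg; rewrite in_cons xe orbT.
rewrite (integral_stepfun_grid tS te q0).
rewrite -(charmod_two_sided_grid (fun k => stepfun phi (t k.+1)) tS pn tp).
by congr charmod; apply/funext => w; rewrite -(step_sum_grid (fun x => L x w) tS te).
Qed.

End two_sided_charmod.

(** * The Levy measure *)

Section levy_measure.
Context {R : realType}.
Variable nu : {measure set R -> \bar R}.
Hypothesis nu_levy : (\int[nu]_x (Num.min 1 (x ^+ 2))%:E < +oo)%E.

Definition levy_exponent (u : R) : R := Rintegral nu setT (fun x => 1 - cos (u * x)).
Local Notation q := levy_exponent.

Lemma measurable_onesubcos (u : R) : measurable_fun setT (fun x : R => 1 - cos (u * x)).
Proof.
apply: measurable_funB => //; apply: measurableT_comp.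
  by case: (@bounded_mfun_cos R).
exact: mulrl_measurable.
Qed.

Lemma integrable_onesubcos u : nu.-integrable setT (fun x : R => (1 - cos (u * x))%:E).
Proof.
have mm : measurable_fun setT (fun x : R => (Num.min 1 (x ^+ 2))%:E).
  apply/measurable_EFinP; apply: measurable_minr; first exact: measurable_cst.
  exact: exprn_measurable.
have m0 (x : R) : 0 <= Num.min 1 (x ^+ 2) by rewrite le_min ler01 sqr_ge0.
have im : nu.-integrable setT (fun x : R => (Num.min 1 (x ^+ 2))%:E).
  apply/integrableP; split => //.
  by under eq_integral do rewrite gee0_abs ?lee_fin//.
apply: (@le_integrable _ _ _ nu setT measurableT _
  (fun x => (2 + u ^+ 2 / 2)%:E * (Num.min 1 (x ^+ 2))%:E)%E).
- by apply/measurable_EFinP; exact: measurable_onesubcos.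
- move=> x _ /=; rewrite lee_fin !ger0_norm ?onesubcos_ge0//; last first.
    by rewrite mulr_ge0// addr_ge0// divr_ge0// sqr_ge0.
  have h1 := onesubcos_le2 (u * x); have h2 := onesubcos_le (u * x).
  have u0 := sqr_ge0 u; have x0 := sqr_ge0 x.
  rewrite exprMn in h2; move: h1 h2; set k := 1 - cos _ => h1 h2.
  by case: (leP 1 (x ^+ 2)) => x1; nra.
- exact: integrableZl.
Qed.

Lemma levy_exponent0 : q 0 = 0.
Proof.
rewrite /q (_ : (fun x => _) = fun=> 0); first by rewrite /Rintegral integral0.
by apply/funext => x; rewrite mul0r cos0 subrr.
Qed.

Lemma levy_exponent_ge0 u : 0 <= q u.
Proof. by apply: Rintegral_ge0 => x _; exact: onesubcos_ge0. Qed.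

Lemma levy_exponentE u : (\int[nu]_x (1 - cos (u * x))%:E = (q u)%:E)%E.
Proof. by rewrite fineK//; apply: integrable_fin_num => //; exact: integrable_onesubcos. Qed.

Lemma Rintegral_cos_sub1 u : Rintegral nu setT (fun x => cos (u * x) - 1) = - q u.
Proof.
rewrite -[RHS]mulN1r /q -RintegralZl//; last exact: integrable_onesubcos.
by congr Rintegral; apply/funext => x; ring.
Qed.

Section second_moment.
Context {d : measure_display} {T : measurableType d}.
Variables (P : probability T R) (Z : T -> R).
Hypothesis mZ : measurable_fun setT Z.
Hypothesis Z2 : (\int[P]_w (Z w ^+ 2)%:E < +oo)%E.
Hypothesis Zq : forall u, charmod P (fun w => u * Z w) = expR (- (2 * q u)).

(** With y = u^2 m/2, the bound on 1 - cos gives E cos(uZ) >= 1 - y, hence exp(-2q) >= 1 - 2y. For y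
    <= 1/4 inversion yields exp(2q) <= 1 + 4y, so q <= 2y. Adding 1 to the second moment makes m
    positive. *)
Lemma levy_exponent_near0 : exists2 m : R, 0 < m &
  forall u, u ^+ 2 * m <= 2^-1 -> q u <= u ^+ 2 * m.
Proof.
have iZ : P.-integrable setT (fun w => (Z w ^+ 2)%:E).
  apply/integrableP; split.
    by apply/measurable_EFinP; exact: measurable_funX.
  by under eq_integral do rewrite gee0_abs ?lee_fin ?sqr_ge0//.
pose m2 := Rintegral P setT (fun w => Z w ^+ 2).
have m20 : 0 <= m2 by apply: Rintegral_ge0 => w _; exact: sqr_ge0.
exists (m2 + 1) => [|u]; first by rewrite ltr_wpDl.
set m := m2 + 1 => um.
have bc : bounded_mfun (fun w => cos (u * Z w)).
  by apply: (bounded_mfun_comp bounded_mfun_cos); exact: measurable_funM.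
pose y := u ^+ 2 * m / 2.
have y0 : 0 <= y by rewrite divr_ge0// mulr_ge0 ?sqr_ge0// addr_ge0.
have y4 : y <= 4^-1 by rewrite /y; lra.
have cy : 1 - y <= Ex P (fun w => cos (u * Z w)).
  have : Ex P (fun w => 1 - cos (u * Z w)) <= Rintegral P setT (fun w => u ^+ 2 / 2 * Z w ^+ 2).
    apply: le_Rintegral => //.
    - apply: bounded_mfun_integrable; apply: bounded_mfunB => //.
      exact: bounded_mfun_cst.
    - by rewrite /comp; under eq_fun do rewrite EFinM; exact: integrableZl.
    - move=> w _; rewrite (le_trans (onesubcos_le _))// exprMn; lra.
  rewrite RintegralZl// ExB ?Ex_cst//; last exact: bounded_mfun_cst.
  rewrite -/m2 /y /m; have := sqr_ge0 u; set c := Ex P _; nra.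
have := Zq u; rewrite /charmod; set c := Ex P _ in cy *; set s := Ex P _ => qE.
have qy : 1 - 2 * y <= expR (- (2 * q u)) by rewrite -qE; nra.
have h1 : expR (2 * q u) * expR (- (2 * q u)) = 1 by rewrite expRxMexpNx_1.
have h2 := expR_ge1Dx (2 * q u).
have h3 : expR (2 * q u) <= 1 + 4 * y.
  have := expR_gt0 (2 * q u); move: h1 qy.
  set a := expR (2 * q u); set b := expR (- _) => h1 qy a0.
  have : a * (1 - 2 * y) <= 1 by rewrite -[leRHS]h1 ler_pM2l.
  nra.
have yE : u ^+ 2 * m = 2 * y by rewrite /y; field.
by rewrite yE; lra.
Qed.

(** On |x| <= N one has x^2 <= 8 N^2 (1 - cos(x/N)), so the truncated moment is at most 8 N^2 q(1/N)
    <= 8 m, uniformly in N; monotone convergence concludes. *)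
Lemma levy_measure_second_moment : (\int[nu]_x (x ^+ 2)%:E < +oo)%E.
Proof.
have [m m0 qm] := levy_exponent_near0.
pose F (n : nat) : set R := [set x | `|x| <= n%:R].
have mF n : measurable (F n).
  rewrite (_ : F n = `[- n%:R, n%:R]%classic); first exact: measurable_itv.
  by apply/seteqP; split => x /=; rewrite /F/= in_itv/= ler_norml.
have ms : measurable_fun setT (fun x : R => (x ^+ 2)%:E).
  by apply/measurable_EFinP; exact: exprn_measurable.
have ndF : nondecreasing_seq F.
  move=> i j ij; apply/subsetPset => x /=; rewrite /F/= => /le_trans; apply.
  by rewrite ler_nat.
have FT : \bigcup_n F n = setT.
  apply/seteqP; split => // x _; exists (Num.truncn `|x|).+1 => //=.
  by rewrite /F/= ltW// truncnS_gt.
have := @ge0_nondecreasing_set_cvg_integral _ R R F (fun x => (x ^+ 2)%:E) nu ndF mF.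
rewrite FT => cv.
have {}cv : (\int[nu]_(x in F i) (x ^+ 2)%:E)%E @[i --> \oo] --> (\int[nu]_x (x ^+ 2)%:E)%E.
  by apply: cv => [i|i x _]; [exact: measurable_funTS|rewrite lee_fin sqr_ge0].
apply: (@le_lt_trans _ _ (8 * m)%:E); last exact: ltry.
apply: (cvge_le _ cv); near=> n.
have n0 : (0 < n)%N by near: n; exists 1%N.
(* Together with N >= 1 this places u = 1/N in the range u^2 m <= 1/2 of the estimate near 0. *)
have N2 : 2 * m <= n%:R by near: n; exact: nbhs_infty_ger.
set N : R := n%:R in N2 *; have N0 : 0 < N by rewrite ltr0n.
have Nm : N^-1 ^+ 2 * m <= 2^-1.
  have N1 : 1 <= N by rewrite ler1n.
  rewrite exprVn mulrC ler_pdivrMr ?exprn_gt0//.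
  by rewrite expr2; nra.
have qN := qm _ Nm.
apply: (@le_trans _ _ (\int[nu]_x ((8 * N ^+ 2)%:E * (1 - cos (N^-1 * x))%:E))%E).
  rewrite integral_mkcond; apply: ge0_le_integral => //.
  - by move=> x _; apply: erestrict_ge0 => ? _; rewrite lee_fin sqr_ge0.
  - by apply/(measurable_restrictT _ _).1 => //; exact: measurable_funTS.
  - by apply: emeasurable_funM => //; apply/measurable_EFinP; exact: measurable_onesubcos.
  - move=> x _; rewrite /patch; case: ifPn => [|_].
      rewrite inE /F/= => xN; rewrite -EFinM lee_fin.
      have Nx : `|N^-1 * x| <= 1.
        by rewrite normrM gtr0_norm ?invr_gt0// mulrC ler_pdivrMr// mul1r.
      have N80 : 0 <= 8 * N ^+ 2 by rewrite mulr_ge0 ?sqr_ge0.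
      rewrite (le_trans _ (ler_wpM2l N80 (onesubcos_ge Nx)))//.
      have -> // : 8 * N ^+ 2 * ((N^-1 * x) ^+ 2 / 8) = x ^+ 2.
      by field; rewrite gt_eqF.
    by rewrite -EFinM lee_fin mulr_ge0 ?onesubcos_ge0// mulr_ge0 ?sqr_ge0.
rewrite integralZl//; last exact: integrable_onesubcos.
rewrite levy_exponentE -EFinM lee_fin.
have -> : 8 * m = 8 * N ^+ 2 * (N^-1 ^+ 2 * m) by field; rewrite gt_eqF.
by rewrite ler_pM2l// mulr_gt0 ?exprn_gt0.
Unshelve. all: by end_near. Qed.

End second_moment.

Hypothesis nu2 : (\int[nu]_x (x ^+ 2)%:E < +oo)%E.

Lemma integrable_sqr : nu.-integrable setT (fun x : R => (x ^+ 2)%:E).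
Proof.
apply/integrableP; split.
  by apply/measurable_EFinP; exact: exprn_measurable.
by under eq_integral do rewrite gee0_abs ?lee_fin ?sqr_ge0//.
Qed.

Definition half_variance : R := Rintegral nu setT (fun x => x ^+ 2) / 2.
Local Notation V := half_variance.

Lemma half_variance_ge0 : 0 <= V.
Proof. by rewrite divr_ge0//; apply: Rintegral_ge0 => x _; exact: sqr_ge0. Qed.

(** Being Lipschitz in u^2 makes q(f) integrable for f in L^2, and its integral continuous in the
    L^2 norm. *)
Lemma levy_exponent_dist y z : `|q y - q z| <= V * `|y ^+ 2 - z ^+ 2|.
Proof.
have iy := integrable_onesubcos y; have iz := integrable_onesubcos z.
rewrite /q -RintegralB//.
have iB : nu.-integrable setT (EFin \o (fun x => 1 - cos (y * x) - (1 - cos (z * x)))).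
  by rewrite /comp; under eq_fun do rewrite EFinB; exact: integrableB.
rewrite (le_trans (le_normr_Rintegral _ _))//.
have -> : V * `|y ^+ 2 - z ^+ 2| = Rintegral nu setT (fun x => `|y ^+ 2 - z ^+ 2| / 2 * x ^+ 2).
  by rewrite RintegralZl//; [rewrite /V; ring|exact: integrable_sqr].
apply: le_Rintegral => //.
- exact: (integrable_norm iB).
- by rewrite /comp; under eq_fun do rewrite EFinM; apply: integrableZl => //; exact: integrable_sqr.
- move=> x _.
  have -> : 1 - cos (y * x) - (1 - cos (z * x)) = cos (z * x) - cos (y * x) by ring.
  rewrite (le_trans (ler_dist_cos_sqr _ _))// !exprMn -mulrBl normrM distrC.
  by rewrite (ger0_norm (sqr_ge0 x)); lra.
Qed.

Lemma continuous_levy_exponent : continuous q.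
Proof.
move=> x; apply/cvgrPdist_le => /= e e0.
have cs : (fun y : R => V * `|x ^+ 2 - y ^+ 2|) @ x --> V * `|x ^+ 2 - x ^+ 2|.
  have cx : (fun y : R => y ^+ 2) @ x --> x ^+ 2 by exact: exprn_continuous.
  apply: cvgM; first exact: cvg_cst.
  by apply: cvg_norm; exact: (cvgB (cvg_cst _) cx).
rewrite subrr normr0 mulr0 in cs.
near=> y; rewrite (le_trans (levy_exponent_dist _ _))//; near: y.
by apply: filterS (@cvgr_lt _ _ _ _ _ _ cs e e0) => y /ltW.
Unshelve. all: by end_near. Qed.

Lemma measurable_levy_exponent : measurable_fun setT q.
Proof. by apply: continuous_measurable_fun; exact: continuous_levy_exponent. Qed.

(** Defined through q because finite dimensional distributions determine integrals of q along linear
    combinations of kernels; [mixed_exponentE] gives the form in which positivity is visible. *)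
Definition mixed_exponent (y z : R) : R :=
  q y + q z - 2^-1 * q (y + z) - 2^-1 * q (y - z).
Local Notation K := mixed_exponent.

Lemma integrable_product_onesubcos y z :
  nu.-integrable setT (EFin \o (fun x => (1 - cos (y * x)) * (1 - cos (z * x)))).
Proof.
apply: (@le_integrable _ _ _ nu setT measurableT _
  (fun x => 2%:E * (1 - cos (y * x))%:E)%E).
- apply/measurable_EFinP; apply: measurable_funM; exact: measurable_onesubcos.
- move=> x _ /=; rewrite lee_fin !ger0_norm ?mulr_ge0 ?onesubcos_ge0//.
  by rewrite mulrC ler_wpM2r ?onesubcos_ge0 ?onesubcos_le2.
- by apply: integrableZl => //; exact: integrable_onesubcos.
Qed.

Lemma mixed_exponentE y z :
  K y z = Rintegral nu setT (fun x => (1 - cos (y * x)) * (1 - cos (z * x))).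
Proof.
have iq := integrable_onesubcos.
have iZ (k : R) u : nu.-integrable setT (EFin \o (fun x => k * (1 - cos (u * x)))).
  by rewrite /comp; under eq_fun do rewrite EFinM; exact: integrableZl.
have iD : nu.-integrable setT (EFin \o (fun x => (1 - cos (y * x)) + (1 - cos (z * x)))).
  by rewrite /comp; under eq_fun do rewrite EFinD; exact: integrableD.
have iB : nu.-integrable setT (EFin \o (fun x => (1 - cos (y * x)) + (1 - cos (z * x))
    - 2^-1 * (1 - cos ((y + z) * x)))).
  by rewrite /comp; under eq_fun do rewrite EFinB; apply: integrableB => //; exact: iZ.
transitivity (Rintegral nu setT (fun x => (1 - cos (y * x)) + (1 - cos (z * x))
    - 2^-1 * (1 - cos ((y + z) * x)) - 2^-1 * (1 - cos ((y - z) * x)))).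
  have h1 := RintegralB measurableT iB (iZ 2^-1 (y - z)).
  have h2 := RintegralB measurableT iD (iZ 2^-1 (y + z)).
  have h3 := RintegralD measurableT (iq y) (iq z).
  by rewrite h1 h2 h3 !RintegralZl//; exact: iq.
by congr Rintegral; apply/funext => x; rewrite product_onesubcos mulrDl mulrBl; ring.
Qed.

Lemma mixed_exponent_ge0 y z : 0 <= K y z.
Proof.
rewrite mixed_exponentE; apply: Rintegral_ge0 => x _.
by rewrite mulr_ge0// onesubcos_ge0.
Qed.

(** The bound is free of z: it provides the dominating function while the second kernel varies with
    t. *)
Lemma mixed_exponent_le y z : K y z <= 2 * q y.
Proof.
rewrite mixed_exponentE /q -RintegralZl//; last exact: integrable_onesubcos.
apply: le_Rintegral => //; first exact: integrable_product_onesubcos.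
  rewrite /comp; under eq_fun do rewrite EFinM.
  by apply: integrableZl => //; exact: integrable_onesubcos.
by move=> x _; rewrite mulrC ler_wpM2r ?onesubcos_ge0 ?onesubcos_le2.
Qed.

(** Some annulus 1/N <= |x| <= N is charged by [nu]. For |y| and |z| at most M = 1/N the products
    with x stay in [-1, 1], where 1 - cos w >= w^2/8. M comes before m because the kernels are
    scaled to fit below M, and m results from that scaling. *)
Lemma mixed_exponent_lbound : nu [set 0] = 0%E -> nu setT <> 0%E ->
  exists2 M : R, 0 < M & forall m, 0 < m -> exists2 del, 0 < del &
    forall y z, m <= `|y| <= M -> m <= `|z| <= M -> del <= K y z.
Proof.
move=> nu0 nuT.
pose B n := [set x : R | n.+1%:R^-1 <= `|x| <= n.+1%:R].
have mB n : measurable (B n).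
  have mle (a : R) : measurable [set x : R | a <= `|x|].
    rewrite (_ : mkset _ = setT `&` normr @^-1` `[a, +oo[).
      by apply: normr_measurable => //; exact: measurable_itv.
    by rewrite setTI; apply/seteqP; split => x /=; rewrite in_itv/= andbT.
  have mge (a : R) : measurable [set x : R | `|x| <= a].
    rewrite (_ : mkset _ = setT `&` normr @^-1` `]-oo, a]).
      by apply: normr_measurable => //; exact: measurable_itv.
    by rewrite setTI; apply/seteqP; split => x /=; rewrite in_itv.
  rewrite (_ : B n = [set x | n.+1%:R^-1 <= `|x|] `&` [set x | `|x| <= n.+1%:R]).
    exact: measurableI.
  by apply/seteqP; split => x /=; [move/andP|move=> ?; apply/andP].
have [n nuB] : exists n, nu (B n) != 0%E.
  apply: contrapT => /forallNP h; apply: nuT.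
  have h' n : nu (B n) = 0%E by apply/eqP; have /negP := h n; rewrite negbK.
  have cov : setT `<=` [set 0] `|` \bigcup_n B n.
    move=> x _; have [->|x0] := eqVneq x 0; [by left|right].
    have nx : 0 < `|x| by rewrite normr_gt0.
    exists (Num.truncn (Num.max `|x| `|x|^-1)) => //=; rewrite /B/=.
    set k := Num.truncn _.
    have kx : Num.max `|x| `|x|^-1 < k.+1%:R by rewrite truncnS_gt.
    rewrite gt_max in kx; case/andP: kx => kx1 kx2.
    by rewrite (ltW kx1) andbT -[leRHS]invrK lef_pV2 ?posrE ?invr_gt0// ltW.
  apply/eqP; rewrite eq_le measure_ge0 andbT.
  have mU : measurable (\bigcup_n B n) by exact: bigcup_measurable.
  rewrite (le_trans (le_measure _ _ _ cov)) ?inE//; first exact: measurableU.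
  apply: (@le_trans _ _ (nu [set 0%R] + nu (\bigcup_n B n))%E); first exact: measureU2.
  rewrite nu0 add0e.
  apply: (@le_trans _ _ (\sum_(n <oo) nu (B n))%E); first exact: measure_sigma_subadditive.
  by rewrite eseries0.
pose N : R := n.+1%:R; have N0 : 0 < N by rewrite ltr0n.
exists N^-1; first by rewrite invr_gt0.
move=> m m0.
pose a := (m * N^-1) ^+ 2 / 8.
have a0 : 0 < a by rewrite divr_gt0// exprn_gt0// mulr_gt0// invr_gt0.
have key y z : m <= `|y| <= N^-1 -> m <= `|z| <= N^-1 ->
    ((a ^+ 2)%:E * nu (B n) <= (K y z)%:E)%E.
  move=> ym zm; rewrite mixed_exponentE fineK; last first.
    by apply: integrable_fin_num => //; exact: integrable_product_onesubcos.
  rewrite -integral_cst// integral_mkcond.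
  apply: ge0_le_integral => //.
  - by move=> x _; apply: erestrict_ge0 => ? _; rewrite lee_fin sqr_ge0.
  - by apply/(measurable_restrictT _ _).1.
  - by apply/measurable_EFinP; apply: measurable_funM; exact: measurable_onesubcos.
  move=> x _; rewrite /patch; case: ifPn => [|_]; last first.
    by rewrite lee_fin mulr_ge0// onesubcos_ge0.
  rewrite inE /B/= => /andP[x1 x2]; rewrite lee_fin expr2.
  have one (v : R) : m <= `|v| <= N^-1 -> a <= 1 - cos (v * x).
    move=> /andP[v1 v2]; apply: (le_trans _ (onesubcos_ge _)); last first.
      by rewrite normrM -(mulVf (lt0r_neq0 N0)) ler_pM.
    rewrite /a ler_pM2r// -(@real_normK _ (v * x)) ?num_real// normrM.
    by rewrite lerXn2r ?nnegrE ?mulr_ge0 ?invr_ge0 ?(ltW m0) ?(ltW N0)// ler_pM// ?invr_ge0 ?ltW.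
  by rewrite ler_pM ?(ltW a0) ?one.
have a20 : (0 < (a ^+ 2)%:E * nu (B n))%E.
  by rewrite mule_gt0 ?lte_fin ?exprn_gt0// lt_neqAle measure_ge0 eq_sym nuB.
(* If no pair is admissible any [del] will do. Otherwise [key] at one pair shows the constant to be
   finite, so that [fine] does not collapse it to 0. *)
have [yz|nyz] := pselect (exists yz : R * R,
    (m <= `|yz.1| <= N^-1) /\ (m <= `|yz.2| <= N^-1)); last first.
  by exists 1 => // y z h1 h2; exfalso; apply: nyz; exists (y, z).
case: yz => -[y0 z0] /= [hy hz].
have fB : ((a ^+ 2)%:E * nu (B n))%E \is a fin_num.
  by rewrite ge0_fin_numE ?(ltW a20)// (le_lt_trans (key _ _ hy hz))// ltry.
exists (fine ((a ^+ 2)%:E * nu (B n))%E).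
  by rewrite fine_gt0// a20 (le_lt_trans (key _ _ hy hz))// ltry.
by move=> y z hy' hz'; rewrite -lee_fin fineK// key.
Qed.

End levy_measure.

(** * Stochastic integrals *)

Lemma cvg_L2_lincomb {d : measure_display} {T : measurableType d} {R : realType}
    (mu : {measure set T -> \bar R}) (a b : R) (u v : nat -> T -> R) :
  (forall m, measurable_fun setT (u m)) -> (forall m, measurable_fun setT (v m)) ->
  (fun m => \int[mu]_x (`|u m x| ^+ 2)%:E)%E @ \oo --> 0%E ->
  (fun m => \int[mu]_x (`|v m x| ^+ 2)%:E)%E @ \oo --> 0%E ->
  (fun m => \int[mu]_x (`|a * u m x + b * v m x| ^+ 2)%:E)%E @ \oo --> 0%E.
Proof.
move=> mu_ mv_ u0 v0.
have msq (g : T -> R) : measurable_fun setT g -> measurable_fun setT (fun x => (`|g x| ^+ 2)%:E).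
  move=> mg; apply/measurable_EFinP; apply: measurable_funX.
  exact: measurableT_comp.
apply: (@squeeze_cvge _ _ _ _ (fun=> 0%E) _
  (fun m => (2 * a ^+ 2)%:E * (\int[mu]_x (`|u m x| ^+ 2)%:E) +
            (2 * b ^+ 2)%:E * (\int[mu]_x (`|v m x| ^+ 2)%:E))%E).
- apply: nearW => m; apply/andP; split.
    by apply: integral_ge0 => x _; rewrite lee_fin exprn_ge0.
  have a20 : 0 <= 2 * a ^+ 2 by rewrite mulr_ge0// sqr_ge0.
  have b20 : 0 <= 2 * b ^+ 2 by rewrite mulr_ge0// sqr_ge0.
  have n0 (g : T -> R) x : (0 <= (`|g x| ^+ 2)%:E)%E by rewrite lee_fin exprn_ge0.
  rewrite -!ge0_integralZl//; try exact: msq.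
  rewrite -ge0_integralD//; try by move=> x _; rewrite mule_ge0 ?lee_fin.
  - apply: ge0_le_integral => //.
    + apply: msq; apply: measurable_funD; apply: measurable_funM => //.
    + by apply: emeasurable_funD; apply: emeasurable_funM => //; exact: msq.
    + move=> x _; rewrite -!EFinM -EFinD lee_fin !real_normK ?num_real//.
      by have := sqr_ge0 (a * u m x - b * v m x); nra.
  - by apply: emeasurable_funM => //; exact: msq.
  - by apply: emeasurable_funM => //; exact: msq.
- exact: cvg_cst.
- rewrite -[X in _ --> X](_ : ((2 * a ^+ 2)%:E * 0 + (2 * b ^+ 2)%:E * 0)%E = 0%E); last first.
    by rewrite !mule0 adde0.
  by apply: cvgeD; [rewrite !mule0|exact: cvgeZl|exact: cvgeZl].
Qed.

Section stoch_integral.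
Context {d : measure_display} {T : measurableType d} {R : realType}.
Variable P : probability T R.
Implicit Types (L : R -> T -> R) (phi : seq (R * R * R)) (f g : R -> R) (Z W : T -> R).

Definition scale_step (c : R) phi : seq (R * R * R) :=
  [seq ((c * p.1.1, p.1.2), p.2) | p <- phi].

Lemma stepfun_lincomb a b phi psi s :
  stepfun (scale_step a phi ++ scale_step b psi) s = a * stepfun phi s + b * stepfun psi s.
Proof.
rewrite /stepfun big_cat/= !big_map/= !mulr_sumr; congr (_ + _);
  by apply: eq_bigr => p _; rewrite mulrA.
Qed.

Lemma step_integral_lincomb L a b phi psi w :
  step_integral L (scale_step a phi ++ scale_step b psi) w =
  a * step_integral L phi w + b * step_integral L psi w.
Proof.
rewrite /step_integral big_cat/= !big_map/= !mulr_sumr; congr (_ + _);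
  by apply: eq_bigr => p _; rewrite mulrA.
Qed.

Lemma is_stoch_integral_lincomb L f g Z W a b :
  (forall phi, measurable_fun setT (step_integral L phi)) ->
  measurable_fun setT f -> measurable_fun setT g ->
  is_stoch_integral P L f Z -> is_stoch_integral P L g W ->
  is_stoch_integral P L (fun s => a * f s + b * g s) (fun w => a * Z w + b * W w).
Proof.
move=> mL mf mg [mZ [phi [phif phiZ]]] [mW [psi [psig psiW]]].
split; first by apply: measurable_funD; apply: measurable_funM.
exists (fun m => scale_step a (phi m) ++ scale_step b (psi m)); split.
- have mphi m : measurable_fun setT (fun s => stepfun (phi m) s - f s).
    by apply: measurable_funB => //; exact: measurable_stepfun.
  have mpsi m : measurable_fun setT (fun s => stepfun (psi m) s - g s).
    by apply: measurable_funB => //; exact: measurable_stepfun.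
  have := @cvg_L2_lincomb _ (measurableTypeR R) R lebesgue_measure a b
    (fun m s => stepfun (phi m) s - f s) (fun m s => stepfun (psi m) s - g s)
    mphi mpsi phif psig.
  apply: cvg_trans; apply: near_eq_cvg; apply: nearW => m.
  apply: eq_integral => s _; congr ((`|_| ^+ 2)%:E).
  by rewrite stepfun_lincomb; ring.
- have mphi m : measurable_fun setT (fun w => step_integral L (phi m) w - Z w).
    exact: measurable_funB.
  have mpsi m : measurable_fun setT (fun w => step_integral L (psi m) w - W w).
    exact: measurable_funB.
  have := cvg_L2_lincomb a b mphi mpsi phiZ psiW.
  apply: cvg_trans; apply: near_eq_cvg; apply: nearW => m.
  apply: eq_integral => w _; congr ((`|_| ^+ 2)%:E).
  by rewrite step_integral_lincomb; ring.
Qed.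

(** Convergence to 0 forces some approximating step function to be at finite L^2 distance from f,
    and step functions are square integrable. *)
Lemma is_stoch_integral_L2 L f Z : measurable_fun setT f ->
  is_stoch_integral P L f Z -> lebesgue_measure.-integrable setT (fun s => (f s ^+ 2)%:E).
Proof.
move=> mf [_ [phi [phif _]]].
have [fin _] := (fine_cvgP _ _).1 phif.
have [m finm] : exists m,
    (\int[lebesgue_measure]_s (`|stepfun (phi m) s - f s| ^+ 2)%:E)%E \is a fin_num.
  by case: fin => m _ /(_ m (leqnn m)); exists m.
have mD : measurable_fun setT (fun s => stepfun (phi m) s - f s).
  by apply: measurable_funB => //; exact: measurable_stepfun.
have iD : lebesgue_measure.-integrable setT (fun s => (`|stepfun (phi m) s - f s| ^+ 2)%:E).
  apply/integrableP; split.
    by apply/measurable_EFinP; apply: measurable_funX; exact: measurableT_comp.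
  under eq_integral do rewrite gee0_abs ?lee_fin ?exprn_ge0//.
  by rewrite -ge0_fin_numE// integral_ge0// => s _; rewrite lee_fin exprn_ge0.
have iS := @integrable_stepfun R (fun x => x ^+ 2) (phi m) (expr0n _ _).
apply: (@le_integrable _ _ _ lebesgue_measure setT measurableT _
  (fun s => 2%:E * ((`|stepfun (phi m) s - f s| ^+ 2)%:E + (stepfun (phi m) s ^+ 2)%:E))%E).
- by apply/measurable_EFinP; exact: measurable_funX.
- move=> s _ /=; rewrite lee_fin real_normK ?num_real//.
  rewrite ger0_norm ?sqr_ge0// ger0_norm; last first.
    by rewrite mulr_ge0// addr_ge0// sqr_ge0.
  by have := sqr_ge0 (2 * stepfun (phi m) s - f s); nra.
- by apply: integrableZl => //; exact: integrableD.
Qed.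

(** A 1-Lipschitz c changes by at most r = |U m - Z|, and r <= eps + r^2/eps. *)
Lemma cvg_Ex_L2 (U : nat -> T -> R) Z (c : R -> R) :
  (forall m, measurable_fun setT (U m)) -> measurable_fun setT Z -> bounded_mfun c ->
  (forall x y, `|c x - c y| <= `|x - y|) ->
  (fun m => \int[P]_w (`|U m w - Z w| ^+ 2)%:E)%E @ \oo --> 0%E ->
  (fun m => Ex P (fun w => c (U m w))) @ \oo --> Ex P (fun w => c (Z w)).
Proof.
move=> mU mZ bc clip e0; apply: (cvg0_eps _ ltr01 e0) => eps m /andP[eps0 _].
have bU : bounded_mfun (fun w => c (U m w)) by exact: bounded_mfun_comp.
have bZ : bounded_mfun (fun w => c (Z w)) by exact: bounded_mfun_comp.
have bD := bounded_mfunB bU bZ.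
rewrite -ExB// !mul1r EFin_normr_Rintegral//; last exact: bounded_mfun_integrable.
have mD := bD.1.
have msq : measurable_fun setT (fun w => (`|U m w - Z w| ^+ 2)%:E).
  apply/measurable_EFinP; apply: measurable_funX; apply: measurableT_comp => //.
  exact: measurable_funB.
apply: (le_trans (le_abse_integral _ _ _)) => //; first exact/measurable_EFinP.
rewrite -ge0_integralZl//; last by rewrite lee_fin invr_ge0 ltW.
have -> : eps%:E = (\int[P]_w eps%:E)%E.
  rewrite integral_cst// -[LHS]mule1; congr (_ * _)%E; apply/esym.
  exact: probability_setT.
rewrite -ge0_integralD//; last 3 first.
- by move=> w _; rewrite lee_fin ltW.
- by move=> w _; rewrite -EFinM lee_fin mulr_ge0 ?invr_ge0 ?exprn_ge0// ltW.
- exact: emeasurable_funM.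
apply: ge0_le_integral => //.
- by apply: measurableT_comp => //; exact/measurable_EFinP.
- by apply: emeasurable_funD => //; exact: emeasurable_funM.
- move=> w _; rewrite /= -?EFinM -?EFinD lee_fin (le_trans (clip _ _))//.
  set r := `|_|; have r0 : 0 <= r by exact: normr_ge0.
  rewrite -(ler_pM2l eps0) mulrDr mulrA divff ?gt_eqF// mul1r.
  have := sqr_ge0 (r - eps); nra.
Qed.

Section exponent_limit.
Variables (q : R -> R) (V : R).
Hypotheses (V0 : 0 <= V) (mq : measurable_fun setT q) (q0 : q 0 = 0).
Hypothesis qlip : forall y z, `|q y - q z| <= V * `|y ^+ 2 - z ^+ 2|.

Lemma integrable_exponent_comp f : measurable_fun setT f ->
  lebesgue_measure.-integrable setT (fun s => (f s ^+ 2)%:E) ->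
  lebesgue_measure.-integrable setT (EFin \o (fun s => q (f s))).
Proof.
move=> mf if2; apply: (@le_integrable _ _ _ lebesgue_measure setT measurableT _
  (fun s => V%:E * (f s ^+ 2)%:E)%E).
- by apply/measurable_EFinP; exact: measurableT_comp.
- move=> s _ /=; rewrite lee_fin.
  have := qlip (f s) 0; rewrite q0 expr0n !subr0 => /le_trans; apply.
  by rewrite (normrM V) (ger0_norm V0).
- exact: integrableZl.
Qed.

(** Writing p^2 - x^2 = (p - x)^2 + 2x(p - x), Young's inequality bounds it by eps x^2 + (2/eps) (p
    - x)^2 for eps <= 1; the first term integrates to eps times the squared norm of f. *)
Lemma cvg_exponent_integral f (phi : nat -> seq (R * R * R)) : measurable_fun setT f ->
  lebesgue_measure.-integrable setT (fun s => (f s ^+ 2)%:E) ->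
  (fun m => \int[lebesgue_measure]_s (`|stepfun (phi m) s - f s| ^+ 2)%:E)%E
    @ \oo --> 0%E ->
  (fun m => Rintegral lebesgue_measure setT (fun s => q (stepfun (phi m) s)))
    @ \oo --> Rintegral lebesgue_measure setT (fun s => q (f s)).
Proof.
move=> mf if2 e0.
pose F := Rintegral lebesgue_measure setT (fun s => f s ^+ 2).
have F0 : 0 <= F by apply: Rintegral_ge0 => s _; exact: sqr_ge0.
have FE : (\int[lebesgue_measure]_s (f s ^+ 2)%:E = F%:E)%E.
  by rewrite fineK//; exact: integrable_fin_num.
(* C dominates V F, the coefficient of eps, and 2 V, the coefficient of 1/eps; the 1 makes it
   positive. *)
pose C := 2 * V + V * F + 1.
have C0 : 0 < C by rewrite ltr_wpDl// addr_ge0 ?mulr_ge0.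
apply: (@cvg0_eps _ _ _ C _ _ C0 e0) => eps m /andP[eps0 eps1].
have iq1 := @integrable_stepfun R q (phi m) q0.
have iq2 := integrable_exponent_comp mf if2.
rewrite -RintegralB// EFin_normr_Rintegral//; last first.
  by rewrite /comp; under eq_fun do rewrite EFinB; exact: integrableB.
have ms := measurable_stepfun (phi m).
have mD : measurable_fun setT (fun s => q (stepfun (phi m) s) - q (f s)).
  by apply: measurable_funB; exact: measurableT_comp.
have msq : measurable_fun setT (fun s => (`|stepfun (phi m) s - f s| ^+ 2)%:E).
  apply/measurable_EFinP; apply: measurable_funX; apply: measurableT_comp => //.
  exact: measurable_funB.
have mf2 : measurable_fun setT (fun s => (f s ^+ 2)%:E).
  by apply/measurable_EFinP; exact: measurable_funX.
apply: (le_trans (le_abse_integral _ _ _)) => //; first exact/measurable_EFinP.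
have c10 : 0 <= V * eps by rewrite mulr_ge0// ltW.
have c20 : 0 <= 2 * V / eps by rewrite divr_ge0 ?mulr_ge0// ltW.
apply: (@le_trans _ _ ((V * eps)%:E * F%:E + (2 * V / eps)%:E *
    \int[lebesgue_measure]_s (`|stepfun (phi m) s - f s| ^+ 2)%:E)%E); last first.
  apply: leeD.
    rewrite -EFinM lee_fin /C.
    have : 0 <= V * eps by []. have : 0 <= V * F * eps by rewrite !mulr_ge0// ltW.
    by nra.
  apply: lee_wpmul2r; first by apply: integral_ge0 => s _; rewrite lee_fin exprn_ge0.
  rewrite lee_fin ler_pM2r ?invr_gt0// /C.
  by have := mulr_ge0 V0 F0; lra.
rewrite -FE -!ge0_integralZl//; try by move=> s _; rewrite lee_fin sqr_ge0.
rewrite -ge0_integralD//; last 4 first.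
- by move=> s _; rewrite -EFinM lee_fin mulr_ge0// sqr_ge0.
- exact: emeasurable_funM.
- by move=> s _; rewrite -EFinM lee_fin mulr_ge0// exprn_ge0.
- exact: emeasurable_funM.
apply: ge0_le_integral => //.
- by apply: measurableT_comp => //; exact/measurable_EFinP.
- by apply: emeasurable_funD; exact: emeasurable_funM.
move=> s _; rewrite /= -?EFinM -?EFinD lee_fin (le_trans (qlip _ _))//.
set p := stepfun _ _; set x := f s.
have -> : V * eps * x ^+ 2 + 2 * V / eps * `|p - x| ^+ 2 =
    V * (eps * x ^+ 2 + 2 * (eps^-1 * `|p - x| ^+ 2)) by ring.
rewrite ler_wpM2l//.
have -> : p ^+ 2 - x ^+ 2 = (p - x) ^+ 2 + 2 * x * (p - x) by ring.
rewrite (le_trans (ler_normD _ _))// (ger0_norm (sqr_ge0 _)) !normrM (@ger0_norm _ 2)//.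
rewrite real_normK ?num_real//.
rewrite -[(p - x) ^+ 2]real_normK ?num_real// -[x ^+ 2]real_normK ?num_real//.
set u := `|p - x|; set v := `|x|.
have u0 : 0 <= u by exact: normr_ge0.
have v0 : 0 <= v by exact: normr_ge0.
rewrite -(ler_pM2l eps0).
have -> : eps * (eps * v ^+ 2 + 2 * (eps^-1 * u ^+ 2)) = (eps * v) ^+ 2 + 2 * u ^+ 2.
  by field; rewrite gt_eqF.
have := sqr_ge0 (eps * v - u); have : 0 <= (1 - eps) * u ^+ 2.
  by rewrite mulr_ge0 ?sqr_ge0// subr_ge0.
nra.
Qed.

Lemma charmod_stoch_integral L f Z :
  (forall phi, measurable_fun setT (step_integral L phi)) ->
  (forall phi, charmod P (step_integral L phi) =
     expR (- (2 * Rintegral lebesgue_measure setT (fun s => q (stepfun phi s))))) ->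
  measurable_fun setT f -> is_stoch_integral P L f Z ->
  charmod P Z = expR (- (2 * Rintegral lebesgue_measure setT (fun s => q (f s)))).
Proof.
move=> mL Lq mf LfZ; have if2 := is_stoch_integral_L2 mf LfZ.
have [mZ [phi [phif phiZ]]] := LfZ.
have mphi m := mL (phi m).
have cc := cvg_Ex_L2 mphi mZ bounded_mfun_cos (@ler_dist_cos R) phiZ.
have cs := cvg_Ex_L2 mphi mZ bounded_mfun_sin (@ler_dist_sin R) phiZ.
have h1 : (fun m => charmod P (step_integral L (phi m))) @ \oo --> charmod P Z.
  rewrite /charmod; under eq_fun do rewrite !expr2; rewrite !expr2.
  by apply: cvgD; exact: cvgM.
have h2 : (fun m => charmod P (step_integral L (phi m))) @ \oo -->
    expR (- (2 * Rintegral lebesgue_measure setT (fun s => q (f s)))).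
  under eq_fun do rewrite Lq.
  apply: continuous_cvg; first exact: continuous_expR.
  apply: cvgN; apply: cvgM; first exact: cvg_cst.
  exact: cvg_exponent_integral.
by rewrite -(cvg_lim _ h1)// (cvg_lim _ h2).
Qed.

End exponent_limit.

End stoch_integral.

(** * The kernels *)

Section power_integral.
Context {R : realType}.
Implicit Types (s t u p : R).

Lemma is_derive_powR_shift s u p : s < u ->
  is_derive u 1 (fun x => (x - s) `^ p) (p * (u - s) `^ (p - 1)).
Proof.
move=> su; have us : 0 < u - s by rewrite subr_gt0.
have h1 := is_derive1_powR p us.
have h2 : is_derive u 1 (fun x : R => x - s) 1.
  by rewrite -[X in is_derive _ _ _ X]subr0; apply: is_deriveB.
have := @is_derive1_comp R (fun x : R => x `^ p) (fun x : R => x - s) u _ _ h1 h2.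
by rewrite mulr1.
Qed.

Lemma continuous_powR_shift s u p : s < u -> {for u, continuous (fun x => (x - s) `^ p)}.
Proof.
move=> su; apply: differentiable_continuous; apply/derivable1_diffP.
by have [] := is_derive_powR_shift p su.
Qed.

Lemma integral_powR_shift s a t p : s < a -> a < t -> 0 < p ->
  (\int[lebesgue_measure]_(u in `[a, t]) ((u - s) `^ (p - 1))%:E =
   (p^-1 * (t - s) `^ p)%:E - (p^-1 * (a - s) `^ p)%:E)%E.
Proof.
move=> sa at_ p0.
have dG u : s < u -> is_derive u 1 (fun x => p^-1 * (x - s) `^ p) ((u - s) `^ (p - 1)).
  move=> su; have h := is_derive_powR_shift p su.
  have := @is_deriveZ R R R (fun x : R => (x - s) `^ p) p^-1 u 1 _ h.
  by rewrite /GRing.scale/= mulrA mulVf ?gt_eqF// mul1r.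
have cG u : s < u -> {for u, continuous (fun x => p^-1 * (x - s) `^ p)}.
  move=> su; apply: differentiable_continuous; apply/derivable1_diffP.
  by have [] := dG _ su.
apply: (@continuous_FTC2 R _ (fun x => p^-1 * (x - s) `^ p)) => //.
- apply: continuous_in_subspaceT => u; rewrite inE/= in_itv/= => /andP[au _].
  exact/continuous_powR_shift/(lt_le_trans sa).
- split.
  + move=> u; rewrite in_itv/= => /andP[au _].
    by have [] := dG _ (lt_trans sa au).
  + exact/cvg_at_right_filter/cG.
  + exact/cvg_at_left_filter/cG/(lt_trans sa).
- move=> u; rewrite in_itv/= => /andP[au _].
  by rewrite derive1E; have [_ ->] := dG _ (lt_trans sa au).
Qed.

(** For p < 1 the integrand is singular at s, so the fundamental theorem is applied on [a n, t] with
    a n decreasing to s, and monotone convergence gives the bound. *)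
Lemma integral_powR_shift_le s t p : s < t -> 0 < p ->
  (\int[lebesgue_measure]_(u in `[s, t]) ((u - s) `^ (p - 1))%:E <=
   (p^-1 * (t - s) `^ p)%:E)%E.
Proof.
move=> st p0.
have mf : measurable_fun setT (fun u : R => ((u - s) `^ (p - 1))%:E).
  apply/measurable_EFinP; apply: (measurableT_comp (measurable_powR _)).
  exact: measurable_funB.
rewrite -integral_itv_obnd_cbnd; last exact: measurable_funTS.
pose a n := s + (t - s) / n.+2%:R.
have ts0 : 0 < t - s by rewrite subr_gt0.
have sa n : s < a n by rewrite ltrDl divr_gt0.
have ta n : a n < t.
  by rewrite /a -ltrBrDl ltr_pdivrMr// ltr_pMr// ltr1n.
pose F n : set R := `[a n, t]%classic.
have ndF : nondecreasing_seq F.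
  move=> i j ij; apply/subsetPset => x /=; rewrite /F/= !in_itv/= => /andP[ix ->].
  rewrite andbT (le_trans _ ix)// lerD2l ler_pM2l// lef_pV2 ?posrE// ler_nat.
  by rewrite !ltnS.
have FU : \bigcup_n F n = `]s, t]%classic.
  apply/seteqP; split => x /=.
    move=> [n _]; rewrite /F/= in_itv/= => /andP[ax xt].
    by rewrite in_itv/= xt andbT (lt_le_trans (sa n)).
  rewrite in_itv/= => /andP[sx xt].
  have xs0 : 0 < x - s by rewrite subr_gt0.
  exists (Num.truncn ((t - s) / (x - s))) => //=; rewrite /F/= in_itv/= xt andbT.
  rewrite /a -lerBrDl ler_pdivrMr// mulrC -ler_pdivrMr//.
  rewrite (le_trans (ltW (truncnS_gt _)))// ler_nat.
  by rewrite leqnSn.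
have := @ge0_nondecreasing_set_cvg_integral _ (measurableTypeR R) R F
  (fun u => ((u - s) `^ (p - 1))%:E) lebesgue_measure ndF.
rewrite FU => cv.
apply: (cvge_le _ (cv _ _ _)).
- apply: nearW => n; rewrite integral_powR_shift// -EFinB lee_fin gerBl.
  by rewrite mulr_ge0 ?powR_ge0// invr_ge0 ltW.
- by move=> n; exact: measurable_itv.
- by move=> n; exact: measurable_funTS.
- by move=> n x _; rewrite lee_fin powR_ge0.
Qed.

End power_integral.

Section kernels.
Context {R : realType}.
Variable H : R.
Hypotheses (H12 : 2^-1 < H) (H1 : H < 1).
Local Notation p := (H - 2^-1).

Let p0 : 0 < p. Proof. by rewrite subr_gt0. Qed.
Let p1 : p < 1. Proof. move: H12 H1 => h12 h1; lra. Qed.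

Lemma posp_ge0 (x : R) : 0 <= posp x.
Proof. by rewrite /posp le_max lexx orbT. Qed.

(* Equal to t^(1-2H): the Molchan-Golosov kernel grows like its inverse. *)
Definition kernel_scale (t : R) : R := (t `^ p * t `^ p)^-1.
Local Notation v := kernel_scale.

Lemma kernel_scale_gt0 t : 0 < t -> 0 < v t.
Proof. by move=> t0; rewrite invr_gt0 mulr_gt0// powR_gt0. Qed.

(** The indicators in this and the next kernel encode the ranges of integration. *)
Definition MvN_kernel (t s : R) : R := f_H H t s * (if s <= t then 1 else 0).
Definition MG_kernel (t s : R) : R := z_H H t s * (if (0 <= s) && (s <= t) then 1 else 0).

(** The real-valued integral is nonnegative, default value included, and the term 1/(2H) makes the
    base of the power positive. *)
Lemma C_H_gt0 : 0 < C_H H.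
Proof.
apply: powR_gt0; rewrite ltr_wpDl//.
  by apply: Rintegral_ge0 => s _; exact: sqr_ge0.
by rewrite invr_gt0 mulr_gt0//; move: H12 => h; lra.
Qed.

Lemma measurable_MvN_kernel t : measurable_fun setT (MvN_kernel t).
Proof.
apply: measurable_funM.
  apply: measurable_funM => //.
  have mposp (g : R -> R) : measurable_fun setT g ->
      measurable_fun setT (fun s => posp (g s) `^ p).
    move=> mg; apply: (measurableT_comp (measurable_powR _)).
    exact: measurable_maxr.
  apply: measurable_funB; apply: mposp; first exact: measurable_funB.
  exact: oppr_measurable.
by apply: measurable_fun_ifT => //; exact: measurable_fun_ler.
Qed.

(** For t >= 1, t - s <= (1 + |s|) t, so the kernel is at most a multiple of (1 + |s|)^p t^p, and
    the scale divides by t^(2p). *)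
Lemma MvN_kernel_bound t s : 1 <= t ->
  0 <= v t * MvN_kernel t s <= C_H H * (1 + `|s|) `^ p * t^-1 `^ p.
Proof.
move=> t1; have t0 : 0 < t by rewrite (lt_le_trans ltr01).
have C0 := C_H_gt0; have v0 := kernel_scale_gt0 t0.
rewrite /MvN_kernel; case: ifPn => st; last first.
  by rewrite !mulr0 lexx/= !mulr_ge0 ?powR_ge0// ltW.
rewrite mulr1 /f_H.
have le1 : posp (- s) `^ p <= posp (t - s) `^ p.
  apply: ge0_ler_powR; rewrite ?nnegrE ?posp_ge0 ?(ltW p0)//.
  by rewrite /posp ge_max !le_max lexx orbT andbT lerDr (ltW t0).
have s1 : 0 <= 1 + `|s| by rewrite addr_ge0.
have le2 : posp (t - s) `^ p <= (1 + `|s|) `^ p * t `^ p.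
  rewrite -powRM ?(ltW t0)//.
  apply: ge0_ler_powR; rewrite ?nnegrE ?posp_ge0 ?(ltW p0) ?mulr_ge0 ?(ltW t0)//.
  rewrite /posp ge_max mulr_ge0 ?(ltW t0)// andbT.
  have := ler_norm (- s); rewrite normrN => ?.
  by have := normr_ge0 s; nra.
have pos0 : 0 <= posp (- s) `^ p by exact: powR_ge0.
have tV : t^-1 `^ p = (t `^ p)^-1.
  by rewrite -(powR_inv1 (ltW t0)) powRAC powR_inv1 ?powR_ge0.
rewrite !mulr_ge0 ?subr_ge0 ?(ltW v0) ?(ltW C0)//=.
have tp0 : 0 < t `^ p by exact: powR_gt0.
rewrite tV -ler_pdivlMl//.
have -> : (v t)^-1 * (C_H H * (1 + `|s|) `^ p * (t `^ p)^-1) =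
    C_H H * ((1 + `|s|) `^ p * t `^ p).
  by rewrite /v; field; rewrite gt_eqF.
rewrite ler_pM2l//; lra.
Qed.

Lemma cvg_MvN_kernel s : (fun n : nat => v n.+1%:R * MvN_kernel n.+1%:R s) @ \oo --> (0 : R).
Proof.
apply: (@squeeze_cvgr _ _ _ _ (fun=> 0)
  (fun n : nat => C_H H * (1 + `|s|) `^ p * n.+1%:R^-1 `^ p)).
- by apply: nearW => n; apply: MvN_kernel_bound; rewrite ler1n.
- exact: cvg_cst.
- rewrite -[X in _ --> X](mulr0 (C_H H * (1 + `|s|) `^ p)).
  apply: cvgM; first exact: cvg_cst.
  have /cvg_at_rightP h := powR_cvg0 p0.
  apply: (h (fun n : nat => n.+1%:R^-1)); split => [n|]; first by rewrite invr_gt0.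
  exact: cvg_harmonic.
Qed.

(** For such s the kernel is C_H (1 - s)^p. The bounds serve the case [c_H H = 0], where this kernel
    is set against the zero kernel. *)
Lemma MvN_kernel1_bound s : 4^-1 <= s <= 2^-1 ->
  C_H H * 2^-1 `^ p <= MvN_kernel 1 s <= C_H H.
Proof.
move=> /andP[s4 s2]; have C0 := C_H_gt0.
have -> : MvN_kernel 1 s = C_H H * (1 - s) `^ p.
  rewrite /MvN_kernel ifT ?mulr1; last by lra.
  rewrite /f_H {2}/posp (max_idPr _) ?powR0 ?subr0 ?gt_eqF//; last by lra.
  by rewrite /posp (max_idPl _)//; lra.
apply/andP; split.
  rewrite ler_pM2l//.
  by apply: ge0_ler_powR; rewrite ?nnegrE ?(ltW p0)//; lra.
have o1 : (1 : R) `^ p = 1 by rewrite powR1.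
rewrite ler_piMr ?(ltW C0)// -[leRHS]o1.
by apply: ge0_ler_powR; rewrite ?nnegrE ?(ltW p0)//; lra.
Qed.

(** The inner integral depends on s through its domain and its integrand; putting the domain into
    the integrand makes it a section integral covered by Tonelli's theorem. *)
Lemma measurable_MG_kernel t : measurable_fun setT (MG_kernel t).
Proof.
apply: measurable_funM; last first.
  apply: measurable_fun_ifT => //; apply: measurable_and; exact: measurable_fun_ler.
rewrite /z_H; apply: measurable_fun_ifT => //.
  by apply: measurable_and; exact: measurable_fun_ltr.
apply: measurable_funM.
  by apply: measurable_funM => //; exact: measurable_powR.
pose g (su : measurableTypeR R * measurableTypeR R) : \bar R :=
  (if (su.1 <= su.2) && (su.2 <= t)
   then su.2 `^ (H - 2^-1) * (su.2 - su.1) `^ (H - 3 / 2) else 0)%:E.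
have mg : measurable_fun setT g.
  apply/measurable_EFinP; apply: measurable_fun_ifT => //.
    by apply: measurable_and; apply: measurable_fun_ler.
  apply: measurable_funM.
    exact: (measurableT_comp (measurable_powR _)).
  apply: (measurableT_comp (measurable_powR _)).
  exact: measurable_funB.
have g0 x : (0 <= g x)%E.
  by rewrite lee_fin; case: ifP => // _; rewrite mulr_ge0 ?powR_ge0.
have mF := @measurable_fun_fubini_tonelli_F _ _ _ _ R lebesgue_measure g mg g0.
have := measurableT_comp (@fine_measurable R setT measurableT) mF.
apply: eq_measurable_fun => s _ /=.
rewrite /fubini_F /Rintegral [in RHS]integral_mkcond; congr fine.
apply: eq_integral => u _; rewrite /g /= /patch.
have [h|h] := boolP ((s <= u) && (u <= t)); first by rewrite mem_set.
by rewrite memNset//; exact/negP.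
Qed.

(** Above, u^p <= t^p and the singular factor integrates to at most t^p/p. Below, the integral is
    restricted to [3t/4, t], which lies to the right of s and has length t/4; there u >= t/2, and (u
    - s)^(p-1) >= t^(p-1) because p < 1. *)
Lemma MG_integral_bounds s t : 4^-1 <= s <= 2^-1 -> 1 <= t ->
  4^-1 * 2^-1 `^ p <= v t * Rintegral lebesgue_measure [set u | s <= u <= t]
      (fun u => u `^ (H - 2^-1) * (u - s) `^ (H - 3 / 2)) <= p^-1.
Proof.
move=> /andP[s4 s2] t1; have t0 : 0 < t by rewrite (lt_le_trans ltr01).
have s0 : 0 < s by lra.
have st : s < t by lra.
have -> : [set u | s <= u <= t] = `[s, t]%classic.
  by apply/seteqP; split => u /=; rewrite in_itv.
have -> : H - 3 / 2 = p - 1 by field.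
set g := fun u : R => u `^ p * (u - s) `^ (p - 1).
have mg : measurable_fun setT (fun u => (g u)%:E).
  apply/measurable_EFinP; apply: measurable_funM; first exact: measurable_powR.
  apply: (measurableT_comp (measurable_powR _)); exact: measurable_funB.
have g0 u : (0 <= (g u)%:E)%E by rewrite lee_fin mulr_ge0 ?powR_ge0.
have tp0 : 0 < t `^ p by exact: powR_gt0.
pose I := (\int[lebesgue_measure]_(u in `[s, t]) (g u)%:E)%E.
have up : (I <= (p^-1 * (t `^ p * t `^ p))%:E)%E.
  apply: (@le_trans _ _ (\int[lebesgue_measure]_(u in `[s, t])
      ((t `^ p)%:E * ((u - s) `^ (p - 1))%:E))%E).
    apply: ge0_le_integral => //.
    - exact: measurable_funTS.
    - apply: emeasurable_funM => //; apply: measurable_funTS.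
      apply/measurable_EFinP; apply: (measurableT_comp (measurable_powR _)).
      exact: measurable_funB.
    - move=> u /=; rewrite in_itv/= => /andP[su ut].
      rewrite -EFinM lee_fin ler_wpM2r ?powR_ge0//.
      by apply: ge0_ler_powR; rewrite ?nnegrE ?(ltW p0) ?(ltW t0)//; lra.
  rewrite ge0_integralZl//; last 3 first.
  - apply: measurable_funTS; apply/measurable_EFinP.
    by apply: (measurableT_comp (measurable_powR _)); exact: measurable_funB.
  - by move=> u _; rewrite lee_fin powR_ge0.
  - by rewrite lee_fin ltW.
  apply: (le_trans (lee_wpmul2l _ (integral_powR_shift_le st p0))).
    by rewrite lee_fin ltW.
  rewrite -EFinM lee_fin mulrCA ler_pM2l ?invr_gt0// ler_pM2l//.
  by apply: ge0_ler_powR; rewrite ?nnegrE ?(ltW p0)//; lra.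
pose a := 3 / 4 * t.
have lo : ((4^-1 * 2^-1 `^ p * (t `^ p * t `^ p))%:E <= I)%E.
  apply: (@le_trans _ _ (\int[lebesgue_measure]_(u in `[a, t]) (g u)%:E)%E); last first.
    apply: ge0_subset_integral => //; first exact: measurable_funTS.
    by move=> u /=; rewrite !in_itv/= => /andP[tu ->]; rewrite andbT; rewrite /a in tu; lra.
  apply: (@le_trans _ _ (\int[lebesgue_measure]_(u in `[a, t])
      ((t / 2) `^ p * t `^ (p - 1))%:E)%E).
    rewrite integral_cst//= [X in (_ * X)%E](_ : _ = (t / 4)%:E); last first.
      apply: etrans; first exact: (lebesgue_measure_itv `[a, t]).
      by rewrite /= lte_fin /a ifT; [rewrite -EFinB; congr EFin; field|lra].
    rewrite -EFinM lee_fin powRM ?(ltW t0)//.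
    rewrite -{2}(mulr_powRB1 (ltW t0) p0).
    by rewrite le_eqVlt; apply/orP; left; apply/eqP; ring.
  apply: ge0_le_integral => //.
  - by move=> u _; rewrite lee_fin mulr_ge0 ?powR_ge0.
  - exact: measurable_funTS.
  - move=> u /=; rewrite in_itv/= /a => /andP[tu ut].
    have us0 : 0 < u - s by lra.
    rewrite lee_fin /g ler_pM ?powR_ge0//.
      by apply: ge0_ler_powR; rewrite ?nnegrE ?(ltW p0)//; lra.
    have := @ge0_ler_powR R (1 - p); rewrite subr_ge0 (ltW p1) => /(_ isT) h.
    rewrite -opprB !powRN lef_pV2 ?posrE ?powR_gt0//.
    by apply: h; rewrite ?nnegrE; lra.
(* Were the integral infinite, [Rintegral] would take its default value 0; the upper bound excludes
   this. *)
have fI : I \is a fin_num.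
  rewrite ge0_fin_numE ?(le_lt_trans up) ?ltry//.
  exact: integral_ge0.
have vE (r : R) : v t * (r * (t `^ p * t `^ p)) = r.
  by rewrite /v; field; rewrite gt_eqF.
have v0 := kernel_scale_gt0 t0.
apply/andP; split.
  by rewrite -[leLHS]vE ler_pM2l// -lee_fin /Rintegral fineK.
by rewrite -[leRHS]vE ler_pM2l// -lee_fin /Rintegral fineK.
Qed.
Lemma kernel_scale1 : v 1 = 1.
Proof. by rewrite /v powR1 mulr1 invr1. Qed.

(** The factor s^(1/2-H) lies between 1 and 4^(H-1/2) on this interval, so the scaled kernel
    inherits the bounds of the inner integral, uniformly in t. *)
Lemma MG_kernel_bounds : c_H H != 0 -> exists m1 m2 : R, 0 < m1 /\
  forall t s, 1 <= t -> 4^-1 <= s <= 2^-1 -> m1 <= `|v t * MG_kernel t s| <= m2.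
Proof.
move=> c0; pose k := `|p * c_H H|.
have k0 : 0 < k by rewrite normr_gt0 mulf_neq0// gt_eqF.
have h0 : 0 < 4^-1 * 2^-1 `^ p :> R by rewrite mulr_gt0// powR_gt0.
exists (k * (4^-1 * 2^-1 `^ p)), (k * ((4^-1 `^ p)^-1 * p^-1)); split.
  exact: mulr_gt0.
move=> t s t1 s42; have /andP[J1 J2] := MG_integral_bounds s42 t1.
have /andP[s4 s2] := s42.
have s0 : 0 < s by lra.
rewrite /MG_kernel /z_H ifT; last by apply/andP; split; lra.
rewrite ifT ?mulr1; last by apply/andP; split; lra.
set J := Rintegral _ _ _ in J1 J2 *.
have -> : v t * (p * c_H H * s `^ (2^-1 - H) * J) =
    p * c_H H * (s `^ (2^-1 - H) * (v t * J)) by ring.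
have vJ0 : 0 <= v t * J by rewrite (le_trans (ltW h0)).
rewrite normrM -/k (ger0_norm (mulr_ge0 (powR_ge0 _ _) vJ0)).
have -> : s `^ (2^-1 - H) = (s `^ p)^-1 by rewrite -powRN opprB.
rewrite !ler_pM2l//.
have sp0 : 0 < s `^ p by exact: powR_gt0.
have sp1 : s `^ p <= 1.
  have o1 : (1 : R) `^ p = 1 by rewrite powR1.
  by rewrite -[leRHS]o1; apply: ge0_ler_powR; rewrite ?nnegrE ?(ltW p0)//; lra.
have sp4 : 4^-1 `^ p <= s `^ p.
  by apply: ge0_ler_powR; rewrite ?nnegrE ?(ltW p0)//; lra.
apply/andP; split.
  rewrite -[leLHS]mul1r; apply: ler_pM; [by []|exact: ltW| |exact: J1].
  by rewrite -[leLHS]invr1 lef_pV2 ?posrE.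
apply: ler_pM; [by rewrite invr_ge0 ltW|exact: vJ0| |exact: J2].
by rewrite lef_pV2 ?posrE// powR_gt0.
Qed.

End kernels.

(** * Mixed exponents *)

Lemma charmod_same_fdd {d : measure_display} {T : measurableType d} {R : realType}
    (P : probability T R) (X Y : R -> T -> R) (s t a b : R) :
  same_fdd P X Y -> 0 <= s -> 0 <= t ->
  measurable_fun setT (X s) -> measurable_fun setT (X t) ->
  measurable_fun setT (Y s) -> measurable_fun setT (Y t) ->
  charmod P (fun w => a * X s w + b * X t w) = charmod P (fun w => a * Y s w + b * Y t w).
Proof.
move=> XY s0 t0 mXs mXt mYs mYt; apply: charmod_same_law.
- by apply: measurable_funD; apply: measurable_funM.
- by apply: measurable_funD; apply: measurable_funM.
move=> B mB; pose G (x : 2.-tuple R) := a * tnth x ord0 + b * tnth x ord_max.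
have mG : measurable_fun setT G.
  by apply: measurable_funD; apply: measurable_funM => //; exact: measurable_tnth.
have mGB : measurable (G @^-1` B) by rewrite -[X in measurable X]setTI; exact: mG.
have st0 i : 0 <= tnth [tuple s; t] i by case: i => [[|[|i]] hi].
exact: (XY 2%N [tuple s; t] st0 (G @^-1` B) mGB).
Qed.

Section lower_bound.
Context {R : realType}.

Lemma Rintegral_quarter_lbound (g : R -> R) del :
  lebesgue_measure.-integrable setT (EFin \o g) -> (forall s, 0 <= g s) ->
  0 <= del -> (forall s, 4^-1 <= s <= 2^-1 -> del <= g s) ->
  del / 4 <= Rintegral lebesgue_measure setT g.
Proof.
move=> ig g0 del0 gdel; rewrite -lee_fin fineK; last exact: integrable_fin_num.
pose D : set R := `[4^-1, 2^-1]%classic.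
apply: (@le_trans _ _ (\int[lebesgue_measure]_(s in D) del%:E)%E).
  rewrite integral_cst//; last exact: measurable_itv.
  rewrite [X in (_ * X)%E](_ : _ = (4^-1)%:E) ?EFinM//.
  apply: etrans; first exact: (lebesgue_measure_itv `[4^-1, 2^-1]).
  by rewrite /= lte_fin ifT; [rewrite -EFinB; congr EFin; field|lra].
have mg : measurable_fun setT (EFin \o g) := measurable_int _ ig.
apply: (@le_trans _ _ (\int[lebesgue_measure]_(s in D) (g s)%:E)%E).
  apply: ge0_le_integral => //.
  - exact: measurable_itv.
  - exact: measurable_funTS.
apply: ge0_subset_integral => //; first exact: measurable_itv.
by move=> s _; rewrite lee_fin.
Qed.

End lower_bound.

Section mixed.
Context {R : realType}.
Variables (nu : {measure set R -> \bar R}).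
Hypothesis nu_levy : (\int[nu]_x (Num.min 1 (x ^+ 2))%:E < +oo)%E.
Hypothesis nu2 : (\int[nu]_x (x ^+ 2)%:E < +oo)%E.
Local Notation q := (levy_exponent nu).
Local Notation K := (mixed_exponent nu).
Local Notation lam := (@lebesgue_measure R).
(** For the integral Z of f against L, this is -ln |E exp(iZ)|. *)
Definition total_exponent (f : R -> R) : R := Rintegral lam setT (fun s => q (f s)).
Local Notation Q := total_exponent.
Definition square_integrable (f : R -> R) := measurable_fun setT f /\
  lam.-integrable setT (fun s => (f s ^+ 2)%:E).

Lemma integrable_levy_exponent f : square_integrable f ->
  lam.-integrable setT (EFin \o (fun s => q (f s))).
Proof.
move=> [mf if2]; apply: (@integrable_exponent_comp _ _ (half_variance nu)) => //.
- exact: half_variance_ge0.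
- exact: measurable_levy_exponent.
- exact: levy_exponent0.
- exact: levy_exponent_dist.
Qed.

Lemma integral_mixed_exponent f g :
  square_integrable f -> square_integrable g ->
  square_integrable (fun s => f s + g s) -> square_integrable (fun s => f s - g s) ->
  lam.-integrable setT (EFin \o (fun s => K (f s) (g s))) /\
  Rintegral lam setT (fun s => K (f s) (g s)) =
  Q f + Q g - 2^-1 * Q (fun s => f s + g s) - 2^-1 * Q (fun s => f s - g s).
Proof.
move=> Lf Lg Lfg Lfg'.
have if_ := integrable_levy_exponent Lf; have ig := integrable_levy_exponent Lg.
have ip := integrable_levy_exponent Lfg; have im := integrable_levy_exponent Lfg'.
have iZ (h : R -> R) : lam.-integrable setT (EFin \o h) ->
    lam.-integrable setT (EFin \o (fun s => 2^-1 * h s)).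
  by move=> ih; rewrite /comp; under eq_fun do rewrite EFinM; exact: integrableZl.
have iD (h k : R -> R) : lam.-integrable setT (EFin \o h) -> lam.-integrable setT (EFin \o k) ->
    lam.-integrable setT (EFin \o (fun s => h s + k s)).
  by move=> ih ik; rewrite /comp; under eq_fun do rewrite EFinD; exact: integrableD.
have iB (h k : R -> R) : lam.-integrable setT (EFin \o h) -> lam.-integrable setT (EFin \o k) ->
    lam.-integrable setT (EFin \o (fun s => h s - k s)).
  by move=> ih ik; rewrite /comp; under eq_fun do rewrite EFinB; exact: integrableB.
have i1 := iD _ _ if_ ig.
have i2 := iB _ _ i1 (iZ _ ip).
have i3 := iB _ _ i2 (iZ _ im).
split; first exact: i3.
have h1 := RintegralB measurableT i2 (iZ _ im).
have h2 := RintegralB measurableT i1 (iZ _ ip).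
have h3 := RintegralD measurableT if_ ig.
by rewrite /mixed_exponent h1 h2 h3 !RintegralZl.
Qed.

Lemma cvg_integral_mixed_exponent0 f (g : nat -> R -> R) : square_integrable f ->
  (forall n, measurable_fun setT (g n)) -> (forall s, g^~ s @ \oo --> (0 : R)) ->
  (fun n => Rintegral lam setT (fun s => K (f s) (g n s))) @ \oo --> (0 : R).
Proof.
move=> Lf mg g0.
have mK n : measurable_fun setT (fun s => K (f s) (g n s)).
  have [mf _] := Lf; have mq := measurable_levy_exponent nu_levy nu2.
  have mc (h : R -> R) : measurable_fun setT h -> measurable_fun setT (fun s => q (h s)).
    by move=> mh; exact: measurableT_comp.
  rewrite /mixed_exponent.
  apply: measurable_funB.
    apply: measurable_funB.
      by apply: measurable_funD; exact: mc.
    by apply: measurable_funM => //; apply: mc; exact: measurable_funD.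
  by apply: measurable_funM => //; apply: mc; exact: measurable_funB.
have cK s : (fun n => K (f s) (g n s)) @ \oo --> (0 : R).
  have cq := continuous_levy_exponent nu_levy nu2.
  have -> : 0 = K (f s) 0.
    by rewrite /mixed_exponent addr0 subr0 levy_exponent0; field.
  rewrite /mixed_exponent.
  have cc (h : nat -> R) l : h @ \oo --> l -> (fun n => q (h n)) @ \oo --> q l.
    by move=> hl; apply: continuous_cvg => //; exact: cq.
  apply: cvgB.
    apply: cvgB.
      by apply: cvgD; [exact: cvg_cst|apply: cc; exact: g0].
    apply: cvgM; first exact: cvg_cst.
    by apply: cc; apply: cvgD; [exact: cvg_cst|exact: g0].
  apply: cvgM; first exact: cvg_cst.
  by apply: cc; apply: cvgB; [exact: cvg_cst|exact: g0].
have [|||||_ _ h] := @dominated_convergence _ (measurableTypeR R) R lam setT measurableT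
  (fun n s => (K (f s) (g n s))%:E) (cst 0%E) (fun s => 2%:E * (q (f s))%:E)%E.
- by move=> n; apply/measurable_EFinP; exact: mK.
- exact: measurable_cst.
- by apply: nearW => s _; apply: cvg_EFin; [exact: nearW|exact: cK].
- by apply: integrableZl => //; exact: integrable_levy_exponent.
- apply: nearW => s n _; rewrite /= -EFinM lee_fin ger0_norm ?mixed_exponent_ge0//.
  exact: mixed_exponent_le.
rewrite integral0 in h.
exact: (fine_cvg h).
Qed.

End mixed.

(** * Comparison of the two processes at times 1 and t *)

Lemma MvN_MG_fdd_differ (d : measure_display) (T : measurableType d)
  (R : realType) (P : probability T R) (H : R)
  (L1 L2 : R -> T -> R) (nu : {measure set R -> \bar R}) (gamma : R)
  (X Y : R -> T -> R) :
  2^-1 < H -> H < 1 ->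
  levy_process P L1 -> levy_process P L2 ->
  independent_processes P L1 L2 -> same_fdd P L1 L2 ->
  (\int[P]_w (L1 1 w ^+ 2)%:E < +oo)%E ->
  nu [set 0] = 0%E ->
  (\int[nu]_x (Num.min 1 (x ^+ 2))%:E < +oo)%E ->
  nu setT <> 0%E ->
  (forall u : R,
     let A := Rintegral nu setT (fun x => cos (u * x) - 1) in
     let B := gamma * u + Rintegral nu setT
                (fun x => sin (u * x) - u * x * (if `|x| <= 1 then 1 else 0)) in
     ('E_P[fun w => cos (u * L1 1%R w)] = (expR A * cos B)%:E)%E /\
     ('E_P[fun w => sin (u * L1 1%R w)] = (expR A * sin B)%:E)%E) ->
  (forall t, 0 <= t -> is_stoch_integral P (two_sided L1 L2) (MvN_kernel H t) (X t)) ->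
  (forall t, 0 <= t -> is_stoch_integral P (two_sided L1 L2) (MG_kernel H t) (Y t)) ->
  ~ same_fdd P X Y.
Proof.
move=> H12 H1 levy1 levy2 ind12 same12 L1sq nu0 nu_levy nuT LK XL YL XY.
pose q := levy_exponent nu.
have mL1 : measurable_fun setT (L1 1) by exact: (levy_measurable levy1).
have mL2 : measurable_fun setT (L2 1) by exact: (levy_measurable levy2).
(* The phase B, which contains the drift and the compensator, drops out by cos^2 + sin^2 = 1. *)
have q1 u : charmod P (fun w => u * L1 1 w) = expR (- (2 * q u)).
  have muL : measurable_fun setT (fun w => u * L1 1 w) by exact: measurable_funM.
  have [] := LK u; rewrite expectation.unlock.
  rewrite ExE; last exact: (bounded_mfun_comp bounded_mfun_cos).
  rewrite ExE; last exact: (bounded_mfun_comp bounded_mfun_sin).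
  rewrite Rintegral_cos_sub1// /charmod; set B := (gamma * u + _) => -[->] [->].
  rewrite !exprMn -mulrDr cos2Dsin2 mulr1 -expRM_natl; congr expR.
  by rewrite mulrN.
have q2 u : charmod P (fun w => u * L2 1 w) = expR (- (2 * q u)).
  rewrite -q1; have := charmod_same_fdd u 0 same12 ler01 ler01 mL1 mL1 mL2 mL2.
  have E (Z : R -> T -> R) : (fun w => u * Z 1 w + 0 * Z 1 w) = (fun w => u * Z 1 w).
    by apply/funext => w; rewrite mul0r addr0.
  by rewrite !E.
have nu2 := levy_measure_second_moment nu_levy mL1 L1sq q1.
have q0 : q 0 = 0 := levy_exponent0 nu.
pose L := two_sided_version L1 L2.
have mstep phi : measurable_fun setT (step_integral L phi).
  exact: (step_integral_measurable levy1 levy2).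
have Lq phi := charmod_step_integral levy1 levy2 ind12 q1 q2 phi q0.
have mf t := measurable_MvN_kernel H t.
have mz t := measurable_MG_kernel H t.
have {}XL t : 0 <= t -> is_stoch_integral P L (MvN_kernel H t) (X t).
  by move=> /XL; exact: is_stoch_integral_version.
have {}YL t : 0 <= t -> is_stoch_integral P L (MG_kernel H t) (Y t).
  by move=> /YL; exact: is_stoch_integral_version.
have mX t : 0 <= t -> measurable_fun setT (X t) by move=> /XL [].
have mY t : 0 <= t -> measurable_fun setT (Y t) by move=> /YL [].
pose Q := total_exponent nu.
have comb (k : R -> R -> R) (Z : R -> T -> R) a b t :
    (forall t, measurable_fun setT (k t)) ->
    (forall t, 0 <= t -> is_stoch_integral P L (k t) (Z t)) -> 0 <= t ->
    square_integrable (fun s => a * k 1 s + b * k t s) /\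
    charmod P (fun w => a * Z 1 w + b * Z t w) =
      expR (- (2 * Q (fun s => a * k 1 s + b * k t s))).
  move=> mk ZL t0.
  have mc : measurable_fun setT (fun s => a * k 1 s + b * k t s).
    by apply: measurable_funD; apply: measurable_funM.
  have sc := is_stoch_integral_lincomb a b mstep (mk 1) (mk t) (ZL 1 ler01) (ZL t t0).
  split; first by split => //; exact: (is_stoch_integral_L2 mc sc).
  apply: (@charmod_stoch_integral _ _ _ P q (half_variance nu) _ _ q0 _ L) => //.
  - exact: half_variance_ge0.
  - exact: measurable_levy_exponent.
  - exact: levy_exponent_dist.
have Qeq a b t : 0 <= t -> Q (fun s => a * MvN_kernel H 1 s + b * MvN_kernel H t s) =
    Q (fun s => a * MG_kernel H 1 s + b * MG_kernel H t s).
  move=> t0; have [_ h1] := comb _ _ a b t mf XL t0.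
  have [_ h2] := comb _ _ a b t mz YL t0.
  have := charmod_same_fdd a b XY ler01 t0 (mX _ ler01) (mX _ t0) (mY _ ler01) (mY _ t0).
  have n2 : (2 : R) != 0 by rewrite pnatr_eq0.
  by rewrite h1 h2 => /expR_inj /oppr_inj /(mulfI n2).
(* The four terms are the exponents for the coefficients (a, 0), (0, b), (a, b) and (a, -b) at times
   1 and t, all of the form covered by [Qeq]. *)
have combK (k : R -> R -> R) (Z : R -> T -> R) a b t :
    (forall t, measurable_fun setT (k t)) ->
    (forall t, 0 <= t -> is_stoch_integral P L (k t) (Z t)) -> 0 <= t ->
    lebesgue_measure.-integrable setT
      (EFin \o (fun s => mixed_exponent nu (a * k 1 s) (b * k t s))) /\
    Rintegral lebesgue_measure setT
      (fun s => mixed_exponent nu (a * k 1 s) (b * k t s)) =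
    Q (fun s => a * k 1 s + 0 * k t s) + Q (fun s => 0 * k 1 s + b * k t s)
    - 2^-1 * Q (fun s => a * k 1 s + b * k t s)
    - 2^-1 * Q (fun s => a * k 1 s + (- b) * k t s).
  move=> mk ZL t0.
  have [] := @integral_mixed_exponent _ nu nu_levy nu2 (fun s => a * k 1 s) (fun s => b * k t s).
  - have [+ _] := comb k Z a 0 t mk ZL t0.
    by under eq_fun do rewrite mul0r addr0.
  - have [+ _] := comb k Z 0 b t mk ZL t0.
    by under eq_fun do rewrite mul0r add0r.
  - by have [] := comb k Z a b t mk ZL t0.
  - have [+ _] := comb k Z a (- b) t mk ZL t0.
    by under eq_fun do rewrite mulNr.
  move=> h1 h2; split => //; rewrite h2.
  have E1 : (fun s => a * k 1 s + 0 * k t s) = (fun s => a * k 1 s).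
    by apply/funext => s; rewrite mul0r addr0.
  have E2 : (fun s => 0 * k 1 s + b * k t s) = (fun s => b * k t s).
    by apply/funext => s; rewrite mul0r add0r.
  have E3 : (fun s => a * k 1 s + (- b) * k t s) = (fun s => a * k 1 s - b * k t s).
    by apply/funext => s; rewrite mulNr.
  by rewrite E1 E2 E3.
have Keq a b t : 0 <= t ->
    Rintegral lebesgue_measure setT
      (fun s => mixed_exponent nu (a * MvN_kernel H 1 s) (b * MvN_kernel H t s)) =
    Rintegral lebesgue_measure setT
      (fun s => mixed_exponent nu (a * MG_kernel H 1 s) (b * MG_kernel H t s)).
  move=> t0; have [_ ->] := combK _ _ a b t mf XL t0.
  by have [_ ->] := combK _ _ a b t mz YL t0; rewrite !Qeq.
have [M M0 Klb] := mixed_exponent_lbound nu_levy nu0 nuT.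
have K0 y z := mixed_exponent_ge0 nu_levy y z.
(* If c_H vanished, the Molchan-Golosov side would be zero for all coefficients, whereas K(a f_1, a
   f_1) has a positive integral; a = M / C_H keeps a f_1 below M. *)
have [c0|c0] := eqVneq (c_H H) 0.
  have z0 t s : MG_kernel H t s = 0.
    by rewrite /MG_kernel /z_H c0 mulr0 !mul0r if_same mul0r.
  have C0 := C_H_gt0 H12.
  pose a := M / C_H H.
  have a0 : 0 < a by exact: divr_gt0.
  pose m := a * (C_H H * 2^-1 `^ (H - 2^-1)).
  have m0 : 0 < m by apply: mulr_gt0 => //; apply: mulr_gt0 => //; exact: powR_gt0.
  have [del del0 Kdel] := Klb m m0.
  have f1 s : 4^-1 <= s <= 2^-1 -> m <= `|a * MvN_kernel H 1 s| <= M.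
    move=> /(MvN_kernel1_bound H12) /andP[f1 f2].
    have f0 : 0 <= MvN_kernel H 1 s by rewrite (le_trans _ f1)// mulr_ge0 ?powR_ge0// ltW.
    rewrite (ger0_norm (mulr_ge0 (ltW a0) f0)); apply/andP; split.
      by rewrite ler_pM2l.
    by rewrite /a mulrAC ler_pdivrMr// ler_pM2l.
  have [iK _] := combK _ _ a a 1 mf XL ler01.
  have := @Rintegral_quarter_lbound _ _ del iK (fun s => K0 _ _) (ltW del0)
    (fun s hs => Kdel _ _ (f1 s hs) (f1 s hs)).
  rewrite Keq//.
  rewrite (_ : (fun s => _) = fun=> 0); last first.
    apply/funext => s; rewrite !z0 !mulr0 /mixed_exponent addr0 subr0 levy_exponent0.
    by rewrite !mulr0 !subr0 addr0.
  by rewrite /Rintegral integral0/= leNgt divr_gt0.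
have [m1 [m2 [m10 zb]]] := MG_kernel_bounds H12 H1 c0.
have m20 : 0 < m2.
  have h : 4^-1 <= (4^-1 : R) <= 2^-1.
    by rewrite lexx andTb lef_pV2 ?posrE// ler_nat.
  by have /andP[h1 h2] := zb 1 4^-1 (lexx _) h; rewrite (lt_le_trans m10)// (le_trans h1).
(* This brings the scaled Molchan-Golosov kernel below the threshold M for all t >= 1 at once. *)
pose a := M / m2; have a0 : 0 < a by exact: divr_gt0.
pose m := a * m1; have m0 : 0 < m by exact: mulr_gt0.
have [del del0 Kdel] := Klb m m0.
pose t (n : nat) : R := n.+1%:R.
have t1 n : 1 <= t n by rewrite ler1n.
have t0 n : 0 <= t n by exact: ler0n.
have zm t' s : 1 <= t' -> 4^-1 <= s <= 2^-1 ->
    m <= `|a * kernel_scale H t' * MG_kernel H t' s| <= M.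
  move=> t'1 s42; have /andP[h1 h2] := zb t' s t'1 s42.
  rewrite -mulrA normrM (gtr0_norm a0); apply/andP; split; first by rewrite ler_pM2l.
  by rewrite /a mulrAC ler_pdivrMr// ler_pM2l.
have low n : del / 4 <= Rintegral lebesgue_measure setT
    (fun s => mixed_exponent nu (a * MvN_kernel H 1 s)
       (a * kernel_scale H (t n) * MvN_kernel H (t n) s)).
  rewrite Keq//; have [iK _] := combK _ _ a (a * kernel_scale H (t n)) (t n) mz YL (t0 n).
  apply: Rintegral_quarter_lbound => //; first exact: ltW.
  move=> s hs; apply: Kdel; last exact: zm.
  (* At time 1 the scale is 1, so the same bounds also cover the first argument of K. *)
  by have := zm 1 s (lexx _) hs; rewrite kernel_scale1 mulr1.
have Lf : square_integrable (fun s => a * MvN_kernel H 1 s).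
  have [+ _] := comb _ _ a 0 1 mf XL ler01.
  by under eq_fun do rewrite mul0r addr0.
have := @cvg_integral_mixed_exponent0 _ nu nu_levy nu2 _
  (fun n s => a * kernel_scale H (t n) * MvN_kernel H (t n) s) Lf.
move=> lim0.
have {}lim0 := lim0 (fun n => measurable_funM (measurable_cst _) (mf _)).
have /lim0 {}lim0 s :
    (fun n => a * kernel_scale H (t n) * MvN_kernel H (t n) s) @ \oo --> (0 : R).
  under eq_fun do rewrite -mulrA; rewrite -(mulr0 a).
  by apply: cvgM; [exact: cvg_cst|exact: cvg_MvN_kernel].
have : del / 4 <= 0.
  rewrite -(cvg_lim _ lim0)//; apply: limr_ge; last exact: nearW.
  by apply/cvg_ex; exists 0.
by rewrite leNgt divr_gt0.
Qed.

Theorem mainTheorem1 (d : measure_display) (T : measurableType d)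
  (R : realType) (P : probability T R) (H : R)
  (L1 L2 : R -> T -> R) (nu : {measure set R -> \bar R}) (gamma : R)
  (X Y : R -> T -> R) :
  2^-1 < H -> H < 1 ->
  (* L1, L2 i.i.d. Levy processes *)
  levy_process P L1 -> levy_process P L2 ->
  independent_processes P L1 L2 -> same_fdd P L1 L2 ->
  (* E L_1 = 0, E L_1^2 < oo *)
  ('E_P[L1 1%R] = 0)%E ->
  (\int[P]_w (L1 1 w ^+ 2)%:E < +oo)%E ->
  (* characteristic triplet (gamma, 0, nu): no Gaussian component,
     nonzero Levy measure nu *)
  nu [set 0] = 0%E ->
  (\int[nu]_x (Num.min 1 (x ^+ 2))%:E < +oo)%E ->
  nu setT <> 0%E ->
  (forall u : R,
     let A := Rintegral nu setT (fun x => cos (u * x) - 1) in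
     let B := gamma * u + Rintegral nu setT
                (fun x => sin (u * x) - u * x * (if `|x| <= 1 then 1 else 0)) in
     ('E_P[fun w => cos (u * L1 1%R w)] = (expR A * cos B)%:E)%E /\
     ('E_P[fun w => sin (u * L1 1%R w)] = (expR A * sin B)%:E)%E) ->
  (* X : fLpMvN, Y : fLpMG driven by the two-sided process L *)
  (forall t, 0 <= t -> is_stoch_integral P (two_sided L1 L2)
       (fun s => f_H H t s * (if s <= t then 1 else 0)) (X t)) ->
  (forall t, 0 <= t -> is_stoch_integral P (two_sided L1 L2)
       (fun s => z_H H t s * (if (0 <= s) && (s <= t) then 1 else 0)) (Y t)) ->
  ((\int[P]_w (`|L1 1 w| ^+ 3)%:E < +oo)%E ->
     (\int[P]_w (L1 1 w ^+ 3)%:E <> 0)%E -> ~ same_fdd P X Y) /\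
  ((\int[P]_w (L1 1 w ^+ 4)%:E < +oo)%E -> ~ same_fdd P X Y).
Proof.
move=> H12 H1 levy1 levy2 ind12 same12 _ L1sq nu0 nu_levy nuT LK XL YL.
have ne := MvN_MG_fdd_differ H12 H1 levy1 levy2 ind12 same12 L1sq nu0 nu_levy nuT LK XL YL.
by split.
Qed.
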